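(* Let $f\colon \mathbb{R}^{m\times n}\to\mathbb{R}$ be continuously differentiable and let $g=f\circ\varphi\colon\mathcal{M}\to\mathbb{R}$, i.e., $g(X,P)=f(X)$. Let $(X_0,P_0)\in\mathcal{M}$ and suppose that the set $\{X\in\mathbb{R}^{m\times n}_{\le r} : f(X)\le f(X_0)\}$ is compact. Then the set $\{(X,P)\in\mathcal{M} : g(X,P)\le g(X_0,P_0)\}$ is also compact. In particular, every sequence $((X_k,P_k))_{k\ge 0}$ in $\mathcal{M}$ starting at $(X_0,P_0)$ whose function values $g(X_k,P_k)$ are non-increasing in $k$ has at least one accumulation point in $\mathcal{M}$. Furthermore, for such a sequence, if $f$ is twice continuously differentiable and every accumulation point of $((X_k,P_k))_{k\ge0}$ is second-order critical for the problem $\min_{(X,P)\in\mathcal{M}} g(X,P)$, then every accumulation point of $(X_k)_{k\ge0}$ is stationary for the problem $\min_{X\in\mathbb{R}^{m\times n}_{\le r}} f(X)$.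
   Context: Let $m,n,r$ be positive integers with $r<\min(m,n)$. Let $\mathrm{Sym}(n)$ be the space of real symmetric $n\times n$ matrices and $\mathrm{Gr}(n,n-r)=\{P\in\mathrm{Sym}(n): P^2=P,\ \mathrm{rank}\,P=n-r\}$. Let $\mathbb{R}^{m\times n}_{\le r}=\{X\in\mathbb{R}^{m\times n}:\mathrm{rank}\,X\le r\}$. The desingularization is the set $\mathcal{M}=\{(X,P)\in\mathbb{R}^{m\times n}\times\mathrm{Gr}(n,n-r): XP=0\}$; it is a smooth embedded submanifold of $\mathcal{E}=\mathbb{R}^{m\times n}\times\mathrm{Sym}(n)$ of dimension $(m+n-r)r$. The map $\varphi\colon\mathcal{M}\to\mathbb{R}^{m\times n}$, $\varphi(X,P)=X$, has image $\mathbb{R}^{m\times n}_{\le r}$. $\mathcal{M}$ is a Riemannian submanifold of $\mathcal{E}$ with the inner product $\langle (Y_1,Z_1),(Y_2,Z_2)\rangle=\langle Y_1,Y_2\rangle+\alpha\langle Z_1,Z_2\rangle$ for a fixed $\alpha>0$ (Frobenius inner products on the right). A point $(X,P)\in\mathcal{M}$ is second-order critical for minimizing $g$ on $\mathcal{M}$ if the Riemannian gradient of $g$ at $(X,P)$ is zero and the Riemannian Hessian of $g$ at $(X,P)$ is positive semidefinite (this notion does not depend on the choice of Riemannian metric). A point $X\in\mathbb{R}^{m\times n}_{\le r}$ is stationary for minimizing $f$ over $\mathbb{R}^{m\times n}_{\le r}$ if $\mathrm{D}f(X)[v]\ge0$ for all $v$ in the (Bouligand) tangent cone to $\mathbb{R}^{m\times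 n}_{\le r}$ at $X$, i.e., all limits $v=\lim_k (X_k-X)/t_k$ with $X_k\in\mathbb{R}^{m\times n}_{\le r}$, $t_k>0$, $t_k\to0$. *)

(* Defs.v *)
From mathcomp Require Export all_boot all_order all_algebra.
From mathcomp Require Export all_classical all_reals all_analysis.

Set Implicit Arguments.
Unset Strict Implicit.
Unset Printing Implicit Defensive.

Import Order.TTheory GRing.Theory Num.Theory.
Import numFieldNormedType.Exports.

Local Open Scope classical_set_scope.
Local Open Scope ring_scope.

(* [V] is meant to be finite-dimensional.  Continuity of [x |-> 'd f x] is
   expressed directionwise, which is then the same as continuity in operator
   norm. *)
Definition continuously_differentiable (R : realType) (V : normedModType R)
    (f : V -> R) : Prop :=
  (forall x : V, differentiable f x) /\
  (forall v : V, continuous (fun x : V => 'd f x v)).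

Definition twice_continuously_differentiable (R : realType)
    (V : normedModType R) (f : V -> R) : Prop :=
  continuously_differentiable f /\
  (forall v : V, continuously_differentiable (fun x : V => 'd f x v)).

(* Riemannian submanifolds of a Euclidean space: [V] is a finite-dimensional
   space with inner product [ip], and [M] is an embedded submanifold of [V],
   given as a set, with the metric inherited from [ip].  Objective functions
   are total functions on [V], but only their values on [M] are used. *)

(* C^oo curves defined around 0, with values in [M], passing through [x] at 0;
   what happens away from 0 is irrelevant. *)
Definition smooth_curve (R : realType) (V : normedModType R) (M : set V)
    (x : V) (c : R -> V) : Prop :=
  c 0 = x /\
  \forall t \near (0 : R), M (c t) /\ forall k, derivable (derive1n k c) t 1.

Definition tangent_space (R : realType) (V : normedModType R) (M : set V)
    (x : V) : set V :=
  [set v | exists2 c : R -> V, smooth_curve M x c & derive1 c 0 = v].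

Definition is_ortho_proj (R : realType) (V : normedModType R)
    (ip : V -> V -> R) (T : set V) (u w : V) : Prop :=
  T w /\ forall v, T v -> ip (u - w) v = 0.

(* [Dg(x)[v]] is the derivative at 0 of [g \o c], for [c] a curve in [M] with
   [c 0 = x] and velocity [v] at 0; [grad g x] is the tangent vector
   representing [Dg(x)]. *)
Definition is_rgrad (R : realType) (V : normedModType R) (ip : V -> V -> R)
    (M : set V) (g : V -> R) (x w : V) : Prop :=
  tangent_space M x w /\
  forall c : R -> V, smooth_curve M x c ->
    is_derive (0 : R) 1 (g \o c) (ip w (derive1 c 0)).

(* Here and for [rhess], [xget 0] picks the unique vector with the stated
   property; the default value 0 is used only if there is none, which does not
   occur for a C^1 (resp. C^2) function on an embedded submanifold. *)
Definition rgrad (R : realType) (V : normedModType R) (ip : V -> V -> R)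
    (M : set V) (g : V -> R) (x : V) : V :=
  xget 0 [set w | is_rgrad ip M g x w].

(* [Hess g x [u]] is the covariant derivative of the vector field [grad g]
   along [u], for the Levi-Civita connection of a Riemannian submanifold: the
   orthogonal projection to the tangent space of the derivative in [V] of
   [grad g] along any curve in [M] with velocity [u] at [x]. *)
Definition is_rhess (R : realType) (V : normedModType R) (ip : V -> V -> R)
    (M : set V) (g : V -> R) (x u h : V) : Prop :=
  forall c : R -> V, smooth_curve M x c -> derive1 c 0 = u ->
    derivable (rgrad ip M g \o c) (0 : R) 1 /\
    is_ortho_proj ip (tangent_space M x) (derive1 (rgrad ip M g \o c) 0) h.

Definition rhess (R : realType) (V : normedModType R) (ip : V -> V -> R)
    (M : set V) (g : V -> R) (x u : V) : V :=
  xget 0 [set h | is_rhess ip M g x u h].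

Definition second_order_critical (R : realType) (V : normedModType R)
    (ip : V -> V -> R) (M : set V) (g : V -> R) (x : V) : Prop :=
  [/\ M x,
      rgrad ip M g x = 0 &
      forall u, tangent_space M x u -> 0 <= ip u (rhess ip M g x u)].

Definition tangent_cone (R : realType) (V : normedModType R) (S : set V)
    (x : V) : set V :=
  [set v | exists (xs : nat -> V) (ts : nat -> R),
     [/\ forall k, S (xs k),
         forall k, 0 < ts k,
         ts @ \oo --> (0 : R) &
         (fun k => (ts k)^-1 *: (xs k - x)) @ \oo --> v]].

Definition stationary (R : realType) (V : normedModType R) (S : set V)
    (f : V -> R) (x : V) : Prop :=
  S x /\ forall v, tangent_cone S x v -> 0 <= 'd f x v.

(* Cluster points of the filter generated by the tails of [u]; in a normed
   space these are the limits of the convergent subsequences of [u]. *)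
Definition accumulation_point (T : topologicalType) (u : nat -> T) (x : T)
    : Prop :=
  cluster (u @ \oo) x.

Definition bounded_rank (R : realType) (m n r : nat) : set 'M[R]_(m, n) :=
  [set X | (\rank X <= r)%N].

Definition grassmannian (R : realType) (n k : nat) : set 'M[R]_n :=
  [set P | [/\ P^T = P, P *m P = P & \rank P = k]].

(* The ambient space is R^(m x n) x Sym(n): the second factor is written ['M_n],
   and symmetry is imposed by [grassmannian], so that tangent vectors also have
   a symmetric second component. *)
Definition desingularization (R : realType) (m n r : nat)
    : set ('M[R]_(m, n) * 'M[R]_n) :=
  [set XP | grassmannian (n - r) XP.2 /\ XP.1 *m XP.2 = 0].

Definition frobenius (R : realType) (m n : nat) (A B : 'M[R]_(m, n)) : R :=
  \tr (A^T *m B).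

Definition desing_inner (R : realType) (m n : nat) (alpha : R)
    (U V : 'M[R]_(m, n) * 'M[R]_n) : R :=
  frobenius U.1 V.1 + alpha * frobenius U.2 V.2.

Definition phi (R : realType) (m n : nat) (XP : 'M[R]_(m, n) * 'M[R]_n)
    : 'M[R]_(m, n) := XP.1.

Arguments bounded_rank R m n r : clear implicits.
Arguments desingularization R m n r : clear implicits.

(* Main.v *)
(** [(X, P)] being second-order critical for [f \o phi] forces [X] to be stationary.
    First-order criticality says that [G = grad f X] satisfies [G P = G] and
    [X^T G = 0].  If [rank X < r], some [q] in the range of [1 - P] is killed by
    [X]; rotating it towards an arbitrary [p] in the range of [P] while moving [X]
    along [a q^T] contributes a term linear in [a^T G p] to the Hessian
    quadratic form, which is otherwise quadratic in [a], so [G P = 0] and [G = 0].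
    If [rank X = r], a sequence [X_k] realizing a tangent vector [V] lifts to
    [(X_k, P_k)]; a cluster point of [P_k] annihilates [X], hence is [P], and
    [G^T (X_k - X) P_k = 0] passes to the limit [G^T V P = 0], so that
    [<G, V> = <G P, V> = 0].  Accumulation points of [X_k] lift to accumulation
    points of [(X_k, P_k)] because the Grassmannian is compact. *)
From mathcomp Require Import ring lra zify.
Require Import Defs.

Set Implicit Arguments.
Unset Strict Implicit.
Unset Printing Implicit Defensive.

Import Order.TTheory GRing.Theory Num.Theory.
Import numFieldNormedType.Exports.

Local Open Scope classical_set_scope.
Local Open Scope ring_scope.

(** * Frobenius inner product, ranks and projectors *)

Section Frobenius.
Variables (R : realType).

Lemma frobeniusC m n (A B : 'M[R]_(m, n)) : frobenius A B = frobenius B A.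
Proof. by rewrite /frobenius -mxtrace_tr trmx_mul trmxK. Qed.

Lemma frobeniusDl m n (A B C : 'M[R]_(m, n)) :
  frobenius (A + B) C = frobenius A C + frobenius B C.
Proof. by rewrite /frobenius linearD mulmxDl mxtraceD. Qed.

Lemma frobeniusNl m n (A C : 'M[R]_(m, n)) : frobenius (- A) C = - frobenius A C.
Proof. by rewrite /frobenius linearN mulNmx linearN. Qed.

Lemma frobeniusBl m n (A B C : 'M[R]_(m, n)) :
  frobenius (A - B) C = frobenius A C - frobenius B C.
Proof. by rewrite frobeniusDl frobeniusNl. Qed.

Lemma frobeniusZl m n a (A C : 'M[R]_(m, n)) :
  frobenius (a *: A) C = a * frobenius A C.
Proof. by rewrite /frobenius linearZ /= -scalemxAl mxtraceZ. Qed.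

Lemma frobeniusDr m n (A B C : 'M[R]_(m, n)) :
  frobenius C (A + B) = frobenius C A + frobenius C B.
Proof. by rewrite !(frobeniusC C) frobeniusDl. Qed.

Lemma frobeniusNr m n (A C : 'M[R]_(m, n)) : frobenius C (- A) = - frobenius C A.
Proof. by rewrite !(frobeniusC C) frobeniusNl. Qed.

Lemma frobeniusZr m n a (A C : 'M[R]_(m, n)) :
  frobenius C (a *: A) = a * frobenius C A.
Proof. by rewrite !(frobeniusC C) frobeniusZl. Qed.

Lemma frobeniusBr m n (A B C : 'M[R]_(m, n)) :
  frobenius C (A - B) = frobenius C A - frobenius C B.
Proof. by rewrite !(frobeniusC C) frobeniusBl. Qed.

Lemma frobenius0l m n (C : 'M[R]_(m, n)) : frobenius 0 C = 0.
Proof. by rewrite /frobenius linear0 mul0mx mxtrace0. Qed.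

Lemma frobenius0r m n (C : 'M[R]_(m, n)) : frobenius C 0 = 0.
Proof. by rewrite frobeniusC frobenius0l. Qed.

Lemma frobenius_tr m n (A B : 'M[R]_(m, n)) :
  frobenius A^T B^T = frobenius A B.
Proof. by rewrite /frobenius trmxK mxtrace_mulC -mxtrace_tr trmx_mul trmxK. Qed.

Lemma frobenius_mull m n p (A : 'M[R]_(m, n)) (B : 'M[R]_(n, p)) C :
  frobenius (A *m B) C = frobenius B (A^T *m C).
Proof. by rewrite /frobenius trmx_mul mulmxA. Qed.

Lemma frobenius_mulr m n p (A : 'M[R]_(m, n)) (B : 'M[R]_(n, p)) C :
  frobenius (A *m B) C = frobenius A (C *m B^T).
Proof. by rewrite /frobenius trmx_mul -mulmxA mxtrace_mulC mulmxA. Qed.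

Lemma frobeniusE m n (A B : 'M[R]_(m, n)) :
  frobenius A B = \sum_j \sum_i A i j * B i j.
Proof.
by apply: eq_bigr => j _; rewrite mxE; apply: eq_bigr => i _; rewrite mxE.
Qed.

Lemma frobenius_ge0 m n (A : 'M[R]_(m, n)) : 0 <= frobenius A A.
Proof.
by rewrite frobeniusE !sumr_ge0 // => j _; rewrite sumr_ge0 // => i _;
  rewrite -expr2 sqr_ge0.
Qed.

Lemma frobenius_eq0 m n (A : 'M[R]_(m, n)) : frobenius A A = 0 -> A = 0.
Proof.
rewrite frobeniusE => /eqP; rewrite psumr_eq0; last first.
  by move=> j _; rewrite sumr_ge0 // => i _; rewrite -expr2 sqr_ge0.
move=> /allP A0; apply/matrixP => i j; rewrite mxE.
have := A0 j (mem_index_enum _); rewrite /= psumr_eq0; last first.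
  by move=> k _; rewrite -expr2 sqr_ge0.
by move=> /allP/(_ i (mem_index_enum _))/=; rewrite mulf_eq0 orbb => /eqP.
Qed.

Lemma unitmx_of_inj n (A : 'M[R]_n) :
  (forall B : 'M[R]_n, B *m A = 0 -> B = 0) -> A \in unitmx.
Proof.
move=> A_inj; rewrite -row_free_unit -kermx_eq0; apply/eqP/A_inj.
exact: mulmx_ker.
Qed.

(** If B annihilates the matrix from the left, pairing with B gives a |B|^2 + |B X^T|^2 = 0, hence B
    = 0. *)
Lemma unitmx_scalar_add_gram m n (a : R) (X : 'M[R]_(m, n)) :
  0 < a -> a%:M + X^T *m X \in unitmx.
Proof.
move=> a_gt0; apply: unitmx_of_inj => B B0; apply: frobenius_eq0.
have : a * frobenius B B + frobenius (B *m X^T) (B *m X^T) = 0.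
  rewrite frobenius_mulr trmxK -mulmxA -frobeniusZr -frobeniusDr.
  by rewrite -mul_mx_scalar -mulmxDr B0 frobenius0r.
have := frobenius_ge0 B; have := frobenius_ge0 (B *m X^T); nra.
Qed.

(** A left annihilator satisfies B = B W, and skewness of W forces <B, B W> = 0, so |B|^2 = 0. *)
Lemma unitmx_1_sub_skew n (W : 'M[R]_n) : W^T = - W -> 1%:M - W \in unitmx.
Proof.
move=> W_skew; apply: unitmx_of_inj => B; rewrite mulmxBr mulmx1.
move=> /eqP; rewrite subr_eq0 => /eqP BW; apply: frobenius_eq0.
have : frobenius B (B *m W) = - frobenius B (B *m W).
  rewrite -{2}[W]opprK -W_skew mulmxN frobeniusNr -frobenius_mulr frobeniusC.
  by rewrite opprK.
rewrite -BW; lra.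
Qed.

Lemma rank_gt_complement m n (P : 'M[R]_n) (Y : 'M[R]_(m, n)) :
  (\rank P < \rank Y)%N -> Y *m (1%:M - P) != 0.
Proof.
apply: contraTN => /eqP; rewrite mulmxBr mulmx1 => /eqP; rewrite subr_eq0.
by move=> /eqP ->; rewrite -leqNgt mxrankM_maxr.
Qed.

(** In a rank factorization P = A B, cancelling A on the left and B on the right of (A B)(A B) = A B
    leaves B A = 1, an identity of size rank P with the same trace as P. *)
Lemma mxtrace_idempotent n (P : 'M[R]_n) : P *m P = P -> \tr P = (\rank P)%:R.
Proof.
have base_id k (A : 'M[R]_(n, k)) (B C : 'M[R]_(k, n)) (D : 'M[R]_(n, k)) :
    C *m A = 1%:M -> B *m D = 1%:M -> (A *m B) *m (A *m B) = A *m B ->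
    B *m A = 1%:M.
  move=> C1 D1 /(congr1 (fun E => C *m E *m D)).
  by rewrite /= !mulmxA C1 !mul1mx -!(mulmxA _ B D) D1 !mulmx1.
move=> PP; rewrite -[in LHS](mulmx_base P) mxtrace_mulC.
have /row_fullP[C C1] := col_base_full P.
have /row_freeP[D D1] := row_base_free P.
by rewrite (base_id _ _ _ _ _ C1 D1) ?mxtrace1 // !mulmx_base.
Qed.

Lemma gram_unitmx k n (B : 'M[R]_(k, n)) : row_free B -> B *m B^T \in unitmx.
Proof.
move=> B_free; apply: unitmx_of_inj => C C0.
apply: (row_free_inj B_free); rewrite mul0mx; apply: frobenius_eq0.
by rewrite frobenius_mulr -mulmxA C0 frobenius0r.
Qed.

Lemma grassmannian_row_space k n (B : 'M[R]_(k, n)) : row_free B ->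
  grassmannian k (B^T *m invmx (B *m B^T) *m B).
Proof.
move=> B_free; set P := _ *m B; have BB := gram_unitmx B_free.
have BP : B *m P = B by rewrite /P !mulmxA mulmxV // mul1mx.
have PT : P^T = P by rewrite /P !trmx_mul trmx_inv trmx_mul trmxK mulmxA.
split => //; first by transitivity (B^T *m invmx (B *m B^T) *m (B *m P));
  [rewrite mulmxA | rewrite BP].
have Pk : \rank B = k by exact/eqP.
by apply/eqP; rewrite -Pk eqn_leq mxrankM_maxr -{1}BP mxrankM_maxr.
Qed.

Lemma bounded_rank_lift m n r (Y : 'M[R]_(m, n)) : bounded_rank R m n r Y ->
  exists2 P, grassmannian (n - r) P & Y *m P = 0.
Proof.
rewrite /bounded_rank /= => Yr; pose K := row_base (kermx Y^T).
(* [B] keeps the first n - r vectors of a basis of the kernel of [Y], which has dimension n - rank Y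
   >= n - r; [P] will be the orthogonal projector onto their span. *)
pose B := (pid_mx (n - r) : 'M[R]_(n - r, _)) *m K.
have KY : K *m Y^T = 0.
  by apply/sub_kermxP; rewrite eq_row_base.
have B_free : row_free B.
  rewrite /row_free mxrankMfree ?row_base_free // rank_pid_mx ?leqnn //.
  by rewrite mxrank_ker mxrank_tr; lia.
exists (B^T *m invmx (B *m B^T) *m B); first exact: grassmannian_row_space.
have YB : Y *m B^T = 0.
  by apply: trmx_inj; rewrite trmx_mul trmxK linear0 -mulmxA KY mulmx0.
by rewrite !mulmxA YB !mul0mx.
Qed.

(** Equal ranks turn the inclusion of row spaces into equality, so P P' = P and P' P = P';
    transposing one of them identifies the two symmetric projectors. *)
Lemma grassmannian_sub_eq k n (P P' : 'M[R]_n) :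
  grassmannian k P -> grassmannian k P' -> (P <= P')%MS -> P = P'.
Proof.
move=> [PT PP Pk] [P'T P'P' P'k] sPP'.
have /submxP[D PD] := sPP'.
have PP' : P *m P' = P by rewrite PD -mulmxA P'P'.
have /submxP[D' P'D'] : (P' <= P)%MS.
  by rewrite -(mxrank_leqif_sup sPP') Pk P'k.
have P'P : P' *m P = P' by rewrite P'D' -mulmxA PP.
by have := congr1 trmx P'P; rewrite trmx_mul PT P'T PP'.
Qed.

(** Both row spaces lie in the kernel of [X], whose dimension is exactly n - r, so each of them
    fills it. *)
Lemma grassmannian_ker_unique m n r (X : 'M[R]_(m, n)) (P P' : 'M[R]_n) :
  \rank X = r -> grassmannian (n - r) P -> grassmannian (n - r) P' ->
  X *m P = 0 -> X *m P' = 0 -> P = P'.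
Proof.
move=> Xr GP GP' XP XP'; have [PT PP Pk] := GP; have [P'T P'P' P'k] := GP'.
have sub_ker Q : Q^T = Q -> X *m Q = 0 -> (Q <= kermx X^T)%MS.
  by move=> QT XQ; apply/sub_kermxP; rewrite -{1}QT -trmx_mul XQ linear0.
apply: (grassmannian_sub_eq GP GP').
apply: submx_trans (sub_ker _ PT XP) _.
have [_ <-] := mxrank_leqif_sup (sub_ker _ P'T XP').
by rewrite P'k mxrank_ker mxrank_tr Xr.
Qed.
End Frobenius.

(** * Tangent vectors to the desingularization *)

Section TangentProjection.
Variables (R : realType) (m n r : nat) (alpha : R).
Hypothesis alpha_gt0 : 0 < alpha.
Implicit Types (X A : 'M[R]_(m, n)) (P B : 'M[R]_n).
Local Notation M := (desingularization R m n r).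

(** Linearizations of X P = 0, P^T = P and P P = P. On the manifold this set is the tangent space,
    by [tangent_space_desing]. *)
Definition desing_tangent (XP : 'M[R]_(m, n) * 'M[R]_n) :
    set ('M[R]_(m, n) * 'M[R]_n) :=
  [set V | [/\ V.1 *m XP.2 + XP.1 *m V.2 = 0, V.2^T = V.2 &
               V.2 *m XP.2 + XP.2 *m V.2 = V.2]].

Lemma desing_tangentB XP V W :
  desing_tangent XP V -> desing_tangent XP W -> desing_tangent XP (V - W).
Proof.
move=> [V1 V2 V3] [W1 W2 W3]; split => /=.
- rewrite mulmxBl mulmxBr addrACA -opprD W1 V1; exact: subr0.
- by rewrite linearB /= V2 W2.
- by rewrite mulmxBl mulmxBr addrACA -opprD W3 V3.
Qed.

Lemma idempotent_sandwich_tangent P (Z : 'M[R]_n) :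
  P *m P = P -> Z *m P + P *m Z = Z -> P *m Z *m P = 0.
Proof.
move=> PP /(congr1 (fun Y => P *m Y)); rewrite mulmxDr !mulmxA PP => /eqP.
by rewrite -subr_eq0 addrK => /eqP.
Qed.

(** Stationarity of |A P + X C|^2 + alpha |B - C - C^T|^2 in C = (1 - P) C P; the factor 2 arises
    because C and C^T are orthogonal and contribute equally. *)
Definition proj_coef X P A B : 'M[R]_n :=
  invmx ((2 * alpha)%:M + X^T *m X) *m
    (alpha *: ((1%:M - P) *m (B + B^T) *m P) - X^T *m A *m P).

(* The minimizer over [C = (1 - P) C P] of the distance from [(A, B)] to
   [(A (1 - P) - X C, C + C^T)], given by its normal equation. *)
Definition desing_proj (XP V : 'M[R]_(m, n) * 'M[R]_n) :
    'M[R]_(m, n) * 'M[R]_n :=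
  let C := proj_coef XP.1 XP.2 V.1 V.2 in
  (V.1 *m (1%:M - XP.2) - XP.1 *m C, C + C^T).

Lemma proj_coefE X P A B :
  (2 * alpha) *: proj_coef X P A B + X^T *m X *m proj_coef X P A B =
  alpha *: ((1%:M - P) *m (B + B^T) *m P) - X^T *m A *m P.
Proof.
rewrite -mul_scalar_mx -mulmxDl /proj_coef mulmxA mulmxV ?mul1mx //.
by rewrite unitmx_scalar_add_gram // mulr_gt0.
Qed.

Lemma proj_coefP X P A B : P *m P = P -> proj_coef X P A B *m P = proj_coef X P A B.
Proof.
move=> PP; rewrite /proj_coef -[LHS]mulmxA; congr (_ *m _).
by rewrite [LHS]mulmxBl -scalemxAl -!mulmxA PP.
Qed.

(** Multiplying the normal equation by P on the left kills every term but 2 alpha P C, since P X^T =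
    0 and P (1 - P) = 0. *)
Lemma mul_proj_coef X P A B : P^T = P -> P *m P = P -> X *m P = 0 ->
  P *m proj_coef X P A B = 0.
Proof.
move=> PT PP XP; have PX : P *m X^T = 0 by rewrite -{1}PT -trmx_mul XP linear0.
have PQ : P *m (1%:M - P) = 0 by rewrite mulmxBr mulmx1 PP subrr.
have := congr1 (mulmx P) (proj_coefE X P A B).
rewrite [X in X = _]mulmxDr [X in _ = X]mulmxBr -!scalemxAr !mulmxA PX PQ.
rewrite !mul0mx scaler0 subrr addr0 => /eqP; rewrite scaler_eq0.
have -> : (2 * alpha == 0) = false by rewrite gt_eqF ?mulr_gt0.
by move=> /eqP.
Qed.

Lemma desing_proj_tangent XP V : M XP -> desing_tangent XP (desing_proj XP V).
Proof.
case: XP => X P [[/= PT PP _] XP]; case: V => A B.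
have PC := mul_proj_coef A B PT PP XP; have CP := proj_coefP X A B PP.
rewrite /desing_proj /=; move: (proj_coef X P A B) PC CP => C PC CP.
have CTP : C^T *m P = 0 by rewrite -{1}PT -trmx_mul PC linear0.
have PCT : P *m C^T = C^T by rewrite -{1}PT -trmx_mul CP.
have XCT : X *m C^T = 0 by rewrite -PCT mulmxA XP mul0mx.
split => /=.
- have QP : (1%:M - P) *m P = 0 by rewrite mulmxBl mul1mx PP subrr.
  rewrite mulmxBl (mulmxDr X) XCT addr0 -!mulmxA CP QP mulmx0 sub0r.
  exact: addNr.
- by rewrite linearD /= trmxK addrC.
- by rewrite mulmxDl mulmxDr CP CTP PC PCT addr0 add0r.
Qed.

(** The relation Y P = - X Z turns all terms in [Y], except <A, Y> which cancels, into pairings with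
    [Z]; what remains is the normal equation tested against [Z]. *)
Lemma desing_proj_ortho XP V W : M XP -> desing_tangent XP W ->
  desing_inner alpha (V - desing_proj XP V) W = 0.
Proof.
case: XP => X P [[/= PT PP _] XP]; case: V => A B; case: W => Y Z [/= YZ ZT PZ].
have PZP := idempotent_sandwich_tangent PP PZ.
rewrite /desing_inner /desing_proj /= !frobeniusBl.
have CE := proj_coefE X P A B; have CP := proj_coefP X A B PP.
set C := proj_coef X P A B in CE CP *.
have YP : Y *m P = - (X *m Z) by apply/eqP; rewrite -addr_eq0 YZ.
have XCY : frobenius (X *m C) Y = - frobenius (X^T *m X *m C) Z.
  rewrite -{1}CP mulmxA frobenius_mulr PT YP frobeniusNr -mulmxA.
  by rewrite [in RHS]frobenius_mull trmxK.
have AY : frobenius (A *m (1%:M - P)) Y =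
    frobenius A Y + frobenius (X^T *m A *m P) Z.
  rewrite mulmxBr mulmx1 frobeniusBl (frobenius_mulr A) PT YP frobeniusNr opprK.
  congr (_ + _); rewrite frobenius_mulr PT frobenius_mull trmxK.
  rewrite -{1}PZ mulmxDr frobeniusDr !mulmxA XP mul0mx frobenius0r addr0.
  by [].
have CT : frobenius (C + C^T) Z = 2 * frobenius C Z.
  by rewrite frobeniusDl -{2}ZT frobenius_tr mulr2n mulrDl mul1r.
(* Relative to range P and its complement, the symmetric matrix [Z] has only off-diagonal blocks, so
   compressing B + B^T to one of them keeps half of its pairing with [Z]. *)
have BZ : 2 * frobenius ((1%:M - P) *m (B + B^T) *m P) Z = 2 * frobenius B Z.
  have BB : frobenius (B + B^T) Z = 2 * frobenius B Z.
    by rewrite frobeniusDl -{2}ZT frobenius_tr mulr2n mulrDl mul1r.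
  have BBT : (B + B^T)^T = B + B^T by rewrite linearD /= trmxK addrC.
  rewrite -BB -{2}PZ.
  have -> : frobenius ((1%:M - P) *m (B + B^T) *m P) Z =
            frobenius (B + B^T) (Z *m P).
    rewrite frobenius_mulr PT frobenius_mull linearB /= trmx1 PT.
    by rewrite mulmxBl mul1mx mulmxA PZP subr0.
  rewrite frobeniusDr -[frobenius _ (P *m Z)]frobenius_tr BBT trmx_mul PT ZT.
  by rewrite mulr2n mulrDl mul1r.
rewrite CT XCY AY; have := congr1 (fun D => frobenius D Z) CE.
rewrite /= [X in X = _]frobeniusDl [X in _ = X -> _]frobeniusBl !frobeniusZl.
have -> : frobenius ((1%:M - P) *m (B + B^T) *m P) Z = frobenius B Z by lra.
lra.
Qed.

Lemma is_ortho_proj_desing XP V : M XP ->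
  is_ortho_proj (desing_inner alpha) (desing_tangent XP) V (desing_proj XP V).
Proof.
move=> MXP; split; first exact: desing_proj_tangent.
by move=> W; exact: desing_proj_ortho.
Qed.

End TangentProjection.

(** * Smooth curves of matrices *)

Section EntrywiseClosure.
Variables (T : Type) (R : realType) (C : (T -> R) -> Prop).
Hypotheses (C_cst : forall a, C (fun=> a))
  (C_add : forall f g, C f -> C g -> C (fun t => f t + g t))
  (C_mul : forall f g, C f -> C g -> C (fun t => f t * g t)).

(** The class [C] is kept abstract because it serves twice: for functions smooth up to order k on
    the line, and for functions derivable at a given point in a given direction. *)
Definition entrywise m n (A : T -> 'M[R]_(m, n)) :=
  forall i j, C (fun t => A t i j).

Lemma closed_sum (I : Type) (s : seq I) (F : I -> T -> R) :
  (forall i, C (F i)) -> C (fun t => \sum_(i <- s) F i t).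
Proof.
move=> CF; elim: s => [|i s IHs].
  by under eq_fun do rewrite big_nil; exact: C_cst.
by under eq_fun do rewrite big_cons; exact: C_add.
Qed.

Lemma closed_prod (I : Type) (s : seq I) (F : I -> T -> R) :
  (forall i, C (F i)) -> C (fun t => \prod_(i <- s) F i t).
Proof.
move=> CF; elim: s => [|i s IHs].
  by under eq_fun do rewrite big_nil; exact: C_cst.
by under eq_fun do rewrite big_cons; exact: C_mul.
Qed.

Lemma entrywise_cst m n (A : 'M[R]_(m, n)) : entrywise (fun=> A).
Proof. by move=> i j; exact: C_cst. Qed.

Lemma entrywiseD m n (A B : T -> 'M[R]_(m, n)) :
  entrywise A -> entrywise B -> entrywise (fun t => A t + B t).
Proof. by move=> CA CB i j; under eq_fun do rewrite mxE; exact: C_add. Qed.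

Lemma entrywiseZ m n f (A : T -> 'M[R]_(m, n)) :
  C f -> entrywise A -> entrywise (fun t => f t *: A t).
Proof. by move=> Cf CA i j; under eq_fun do rewrite mxE; exact: C_mul. Qed.

Lemma entrywiseB m n (A B : T -> 'M[R]_(m, n)) :
  entrywise A -> entrywise B -> entrywise (fun t => A t - B t).
Proof.
move=> CA CB; under eq_fun do rewrite -scaleN1r.
by apply: entrywiseD => //; apply: entrywiseZ.
Qed.

Lemma entrywise_tr m n (A : T -> 'M[R]_(m, n)) :
  entrywise A -> entrywise (fun t => (A t)^T).
Proof. by move=> CA i j; under eq_fun do rewrite mxE; exact: CA. Qed.

Lemma entrywiseM m n p (A : T -> 'M[R]_(m, n)) (B : T -> 'M[R]_(n, p)) :
  entrywise A -> entrywise B -> entrywise (fun t => A t *m B t).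
Proof.
move=> CA CB i j; under eq_fun do rewrite mxE.
by apply: closed_sum => k; exact: C_mul.
Qed.

Lemma closed_det n (A : T -> 'M[R]_n) : entrywise A -> C (fun t => \det (A t)).
Proof.
move=> CA; rewrite /determinant; apply: closed_sum => s.
by apply: C_mul => //; apply: closed_prod => i; exact: CA.
Qed.

(** Cramer's rule: the entries of the inverse are signed minors times the inverse of the
    determinant, which is assumed in [C] since [C] need not be closed under inversion. *)
Lemma entrywise_inv n (A : T -> 'M[R]_n) :
  (forall t, A t \in unitmx) -> C (fun t => (\det (A t))^-1) ->
  entrywise A -> entrywise (fun t => invmx (A t)).
Proof.
move=> A_unit CdetV CA; under eq_fun do rewrite /invmx A_unit.
apply: entrywiseZ => // i j; under eq_fun do rewrite mxE /cofactor.
apply: C_mul => //; apply: closed_det => i' j'.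
by under eq_fun do rewrite !mxE; exact: CA.
Qed.

End EntrywiseClosure.

(** * Real functions differentiable up to a given order *)

Section SmoothFunctions.
Variable (R : realType).
Implicit Types (f g : R -> R) (k : nat).

(** The derivative of order [k] must itself be derivable, so [smooth_upto 0] already means
    derivability everywhere. *)
Definition smooth_upto k f :=
  forall j, (j <= k)%N -> forall t : R, derivable (derive1n j f) t 1.

Lemma smooth_uptoS k f : smooth_upto k.+1 f <->
  (forall t : R, derivable f t 1) /\ smooth_upto k (derive1 f).
Proof.
split=> [sf | [df sf] [|j] jk]; last 1 first.
- by rewrite derive1Sn; exact: sf.
- split=> [t|j jk t]; first exact: (sf 0%N).
  by rewrite -derive1Sn; exact: sf.
- exact: df.
Qed.

Lemma smooth_upto0 f : smooth_upto 0 f <-> forall t : R, derivable f t 1.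
Proof.
split=> [sf t|df j]; first exact: (sf 0%N).
by rewrite leqn0 => /eqP -> t; exact: df.
Qed.

Lemma smooth_upto_derivable k f (t : R) : smooth_upto k f -> derivable f t 1.
Proof. by move=> /(_ 0%N); apply. Qed.

Lemma smooth_upto_pred k f : smooth_upto k.+1 f -> smooth_upto k f.
Proof. by move=> sf j jk; apply: sf; exact: leqW. Qed.

Lemma smooth_upto_cst k (a : R) : smooth_upto k (fun=> a).
Proof.
elim: k a => [|k IHk] a; first by apply/smooth_upto0 => t; exact: derivable_cst.
apply/smooth_uptoS; split=> [t|]; first exact: derivable_cst.
suff -> : derive1 (fun=> a : R) = (fun=> 0 : R) by [].
by apply/funext => t; rewrite derive1_cst.
Qed.

Lemma smooth_upto_id k : smooth_upto k id.
Proof.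
case: k => [|k]; first by apply/smooth_upto0 => t; exact: derivable_id.
apply/smooth_uptoS; split=> [t|]; first exact: derivable_id.
suff -> : derive1 (@id R) = (fun=> 1 : R) by exact: smooth_upto_cst.
by apply/funext => t; rewrite derive1_id.
Qed.

Lemma smooth_uptoD k f g :
  smooth_upto k f -> smooth_upto k g -> smooth_upto k (fun t => f t + g t).
Proof.
elim: k f g => [|k IHk] f g.
  move=> /smooth_upto0 df /smooth_upto0 dg.
  by apply/smooth_upto0 => t; exact: derivableD.
move=> /smooth_uptoS[df sf] /smooth_uptoS[dg sg].
apply/smooth_uptoS; split=> [t|]; first exact: derivableD.
suff -> : derive1 (fun t => f t + g t) = (fun t => derive1 f t + derive1 g t).
  exact: IHk.
by apply/funext => t; rewrite !derive1E deriveD.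
Qed.

Lemma smooth_uptoM k f g :
  smooth_upto k f -> smooth_upto k g -> smooth_upto k (fun t => f t * g t).
Proof.
elim: k f g => [|k IHk] f g.
  move=> /smooth_upto0 df /smooth_upto0 dg.
  by apply/smooth_upto0 => t; exact: derivableM.
move=> sf sg; have [df sf'] := (smooth_uptoS _ _).1 sf.
have [dg sg'] := (smooth_uptoS _ _).1 sg.
apply/smooth_uptoS; split=> [t|]; first exact: derivableM.
suff -> : derive1 (fun t => f t * g t) =
    (fun t => f t * derive1 g t + g t * derive1 f t).
  have [sf0 sg0] := (smooth_upto_pred sf, smooth_upto_pred sg).
  exact: smooth_uptoD (IHk _ _ sf0 sg') (IHk _ _ sg0 sf').
by apply/funext => t; rewrite !derive1E deriveM.
Qed.

(** The derivative - f' / f^2 is a product of f' with copies of 1 / f, which the induction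
    hypothesis controls one order lower. *)
Lemma smooth_uptoV k f :
  (forall t, f t != 0) -> smooth_upto k f -> smooth_upto k (fun t => (f t)^-1).
Proof.
move=> f_neq0; elim: k => [|k IHk] sf.
  apply/smooth_upto0 => t; apply: derivableV => //.
  exact: smooth_upto_derivable sf.
have [df sf'] := (smooth_uptoS _ _).1 sf.
apply/smooth_uptoS; split=> [t|]; first exact: derivableV.
suff -> : derive1 (fun t => (f t)^-1) =
    (fun t => -1 * ((f t)^-1 * (f t)^-1 * derive1 f t)).
  have sV := IHk (smooth_upto_pred sf).
  have sVf := smooth_uptoM (smooth_uptoM sV sV) sf'.
  by apply: smooth_uptoM sVf; exact: smooth_upto_cst.
apply/funext => t; rewrite !derive1E deriveV // /GRing.scale /=.
by rewrite mulN1r expr2 invfM mulNr.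
Qed.

Definition smooth_mx m n (A : R -> 'M[R]_(m, n)) :=
  forall k, entrywise (smooth_upto k) A.

Lemma smooth_mx_cst m n (A : 'M[R]_(m, n)) : smooth_mx (fun=> A).
Proof. by move=> k; apply: entrywise_cst; exact: smooth_upto_cst. Qed.

Lemma smooth_mxD m n (A B : R -> 'M[R]_(m, n)) :
  smooth_mx A -> smooth_mx B -> smooth_mx (fun t => A t + B t).
Proof. by move=> sA sB k; exact (entrywiseD (@smooth_uptoD k) (sA k) (sB k)). Qed.

Lemma smooth_mxB m n (A B : R -> 'M[R]_(m, n)) :
  smooth_mx A -> smooth_mx B -> smooth_mx (fun t => A t - B t).
Proof.
move=> sA sB k.
exact (entrywiseB (@smooth_upto_cst k) (@smooth_uptoD k) (@smooth_uptoM k)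
  (sA k) (sB k)).
Qed.

Lemma smooth_mx_scale m n (A : 'M[R]_(m, n)) : smooth_mx (fun t => t *: A).
Proof.
move=> k; exact (entrywiseZ (@smooth_uptoM k) (@smooth_upto_id k)
  (@smooth_mx_cst _ _ A k)).
Qed.

Lemma smooth_mx_tr m n (A : R -> 'M[R]_(m, n)) :
  smooth_mx A -> smooth_mx (fun t => (A t)^T).
Proof. by move=> sA k; exact: entrywise_tr. Qed.

Lemma smooth_mxM m n p (A : R -> 'M[R]_(m, n)) (B : R -> 'M[R]_(n, p)) :
  smooth_mx A -> smooth_mx B -> smooth_mx (fun t => A t *m B t).
Proof.
move=> sA sB k.
exact (entrywiseM (@smooth_upto_cst k) (@smooth_uptoD k) (@smooth_uptoM k)
  (sA k) (sB k)).
Qed.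

Lemma smooth_mx_inv n (A : R -> 'M[R]_n) : (forall t, A t \in unitmx) ->
  smooth_mx A -> smooth_mx (fun t => invmx (A t)).
Proof.
move=> A_unit sA k; have [cstk Dk Mk] :=
  And3 (@smooth_upto_cst k) (@smooth_uptoD k) (@smooth_uptoM k).
apply: (entrywise_inv cstk Dk Mk A_unit _ (sA k)).
apply: smooth_uptoV (closed_det cstk Dk Mk (sA k)) => t.
by rewrite -unitfE -unitmxE.
Qed.

End SmoothFunctions.

(** * Differentiation rules for matrix-valued maps *)

Section MatrixDerivatives.
Variable (R : realType).

Lemma is_derive_mxP (V : normedModType R) m n (A : V -> 'M[R]_(m, n)) t v dA :
  is_derive t v A dA <-> forall i j, is_derive t v (fun x => A x i j) (dA i j).
Proof.
split=> [[dAt <-] i j|dAij].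
  have dAij := (derivable_mxP A t v).1 dAt.
  by apply: DeriveDef; [exact: dAij|rewrite derive_mx // mxE].
have dAt : derivable A t v by apply/derivable_mxP => i j; have [] := dAij i j.
apply: DeriveDef => //; rewrite derive_mx //; apply/matrixP => i j; rewrite mxE.
by have [_ ->] := dAij i j.
Qed.

Lemma is_derive_linear (V W U : normedModType R) (L : {linear W -> U})
    (c : V -> W) t v dc : continuous L -> is_derive t v c dc ->
  is_derive t v (L \o c) (L dc).
Proof.
move=> L_cont [dct dcE].
have cvgL : (fun h => h^-1 *: ((L \o c) (h *: v + t) - (L \o c) t)) @ 0^' -->
    L dc.
  have -> : (fun h => h^-1 *: ((L \o c) (h *: v + t) - (L \o c) t)) =
      L \o (fun h => h^-1 *: (c (h *: v + t) - c t)).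
    apply/funext => h; rewrite /= [RHS]linearZ /=; congr (_ *: _).
    by rewrite linearB.
  rewrite -dcE; apply: cvg_comp; last exact: L_cont.
  exact: dct.
apply: DeriveDef; first by apply/cvg_ex; exists (L dc).
exact: cvg_lim cvgL.
Qed.

Lemma is_derive_pair (V W U : normedModType R) (a : V -> W) (b : V -> U)
    t v da db : is_derive t v a da -> is_derive t v b db ->
  is_derive t v (fun x => (a x, b x)) (da, db).
Proof.
move=> [dat daE] [dbt dbE].
have cvgab : (fun h => h^-1 *: ((a (h *: v + t), b (h *: v + t)) - (a t, b t)))
    @ 0^' --> (da, db).
  by rewrite -daE -dbE; apply: cvg_pair; [exact: dat|exact: dbt].
apply: DeriveDef; first by apply/cvg_ex; exists (da, db).
exact: cvg_lim cvgab.
Qed.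

Lemma is_derive_fst (V W U : normedModType R) (c : V -> W * U) t v dc :
  is_derive t v c dc -> is_derive t v (fun x => (c x).1) dc.1.
Proof. apply: (@is_derive_linear V _ _ fst). by move=> x; exact: cvg_fst. Qed.

Lemma is_derive_snd (V W U : normedModType R) (c : V -> W * U) t v dc :
  is_derive t v c dc -> is_derive t v (fun x => (c x).2) dc.2.
Proof. apply: (@is_derive_linear V _ _ snd). by move=> x; exact: cvg_snd. Qed.

Lemma is_derive_mulmx (V : normedModType R) m n p
    (A : V -> 'M[R]_(m, n)) (B : V -> 'M[R]_(n, p)) t v dA dB :
  is_derive t v A dA -> is_derive t v B dB ->
  is_derive t v (fun x => A x *m B x) (dA *m B t + A t *m dB).
Proof.
move=> /is_derive_mxP dAt /is_derive_mxP dBt; apply/is_derive_mxP => i j.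
have -> : (fun x => (A x *m B x) i j) =
    \sum_(k < n) ((fun x => A x i k) * (fun x => B x k j)).
  by apply/funext => x; rewrite fct_sumE mxE.
have dAB (k : 'I_n) := is_deriveM (dAt i k) (dBt k j).
have dS := is_derive_sum dAB.
apply: (is_derive_eq dS); rewrite !mxE -big_split /=; apply: eq_bigr => k _.
by rewrite addrC /GRing.scale /=; congr (_ + _); exact: mulrC.
Qed.

Lemma is_derive_trmx (V : normedModType R) m n (A : V -> 'M[R]_(m, n)) t v dA :
  is_derive t v A dA -> is_derive t v (fun x => (A x)^T) dA^T.
Proof.
move=> /is_derive_mxP dAt; apply/is_derive_mxP => i j.
by under eq_fun do rewrite mxE; rewrite mxE.
Qed.

Lemma derivable_invmx (V : normedModType R) n (A : V -> 'M[R]_n) t v :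
  (forall x, A x \in unitmx) -> derivable A t v ->
  derivable (fun x => invmx (A x)) t v.
Proof.
move=> A_unit /derivable_mxP dA; apply/derivable_mxP.
have cstP (a : R) : derivable (fun=> a : R) t v by exact: derivable_cst.
have addP (f g : V -> R) : derivable f t v -> derivable g t v ->
  derivable (fun x => f x + g x) t v by exact: derivableD.
have mulP (f g : V -> R) : derivable f t v -> derivable g t v ->
  derivable (fun x => f x * g x) t v by exact: derivableM.
apply: (entrywise_inv cstP addP mulP A_unit) => //.
apply: derivableV; first by rewrite -unitfE -unitmxE.
exact: (closed_det cstP addP mulP).
Qed.

(** Once the inverse is known to be derivable, its derivative is found by differentiating A A^-1 = 1
    and solving. *)
Lemma is_derive_invmx (V : normedModType R) n (A : V -> 'M[R]_n) t v dA :
  (forall x, A x \in unitmx) -> is_derive t v A dA ->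
  is_derive t v (fun x => invmx (A x)) (- (invmx (A t) *m dA *m invmx (A t))).
Proof.
move=> A_unit dAt; have [dA' _] := dAt.
have dN := derivableP (derivable_invmx A_unit dA').
apply: (is_derive_eq dN); set N := (X in X = _).
have := is_derive_mulmx dAt dN.
under eq_fun do rewrite mulmxV //.
move=> [_]; rewrite derive_cst => /esym/(congr1 (mulmx (invmx (A t)))).
rewrite mulmxDr mulmx0 [X in _ + X]mulmxA mulVmx // mul1mx mulmxA => /eqP.
by rewrite addrC addr_eq0 => /eqP.
Qed.

Lemma derive1n_mx m n (A : R -> 'M[R]_(m, n)) k : smooth_mx A ->
  derive1n k A = fun t => \matrix_(i, j) derive1n k (fun x => A x i j) t.
Proof.
move=> sA; elim: k => [|k IHk].
  by apply/funext => t; apply/matrixP => i j; rewrite mxE.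
rewrite derive1nS IHk; apply/funext => t; rewrite derive1E derive_mx.
  apply/matrixP => i j; rewrite !mxE derive1nS derive1E.
  by under eq_fun do rewrite mxE.
apply/derivable_mxP => i j; under eq_fun do rewrite mxE.
exact: (sA k).
Qed.

Lemma smooth_mx_derivable m n (A : R -> 'M[R]_(m, n)) k (t : R) :
  smooth_mx A -> derivable (derive1n k A) t 1.
Proof.
move=> sA; rewrite derive1n_mx //; apply/derivable_mxP => i j.
by under eq_fun do rewrite mxE; exact: (sA k).
Qed.

Lemma derive1n_pair m n p q (A : R -> 'M[R]_(m, n)) (B : R -> 'M[R]_(p, q)) k :
  smooth_mx A -> smooth_mx B ->
  derive1n k (fun t => (A t, B t)) = fun t => (derive1n k A t, derive1n k B t).
Proof.
move=> sA sB; elim: k => [//|k IHk].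
rewrite derive1nS IHk; apply/funext => t; rewrite derive1E.
have dA := derivableP (@smooth_mx_derivable _ _ _ k t sA).
have dB := derivableP (@smooth_mx_derivable _ _ _ k t sB).
have [_ ->] := is_derive_pair dA dB.
by rewrite !derive1nS !derive1E.
Qed.

Lemma smooth_pair_derivable m n p q (A : R -> 'M[R]_(m, n))
    (B : R -> 'M[R]_(p, q)) k (t : R) : smooth_mx A -> smooth_mx B ->
  derivable (derive1n k (fun t => (A t, B t))) t 1.
Proof.
move=> sA sB; rewrite derive1n_pair //.
have dA := derivableP (@smooth_mx_derivable _ _ _ k t sA).
have dB := derivableP (@smooth_mx_derivable _ _ _ k t sB).
by have [] := is_derive_pair dA dB.
Qed.

Lemma is_derive_comp_diff (V W : normedModType R) (f : V -> W) (c : R -> V)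
    (t : R) dc : differentiable f (c t) -> is_derive t 1 c dc ->
  is_derive t 1 (f \o c) ('d f (c t) dc).
Proof.
move=> df [dc' dcE]; have dc2 := (derivable1_diffP _ _).1 dc'.
have dfc : differentiable (f \o c) t by exact: differentiable_comp.
apply: DeriveDef; first exact/derivable1_diffP.
rewrite -dcE !deriveE // diff_comp //.
Qed.

End MatrixDerivatives.

(** * Curves in the desingularization *)

Section TangentSpace.
Variables (R : realType) (m n r : nat).
Local Notation M := (desingularization R m n r).
Implicit Types (X : 'M[R]_(m, n)) (P W : 'M[R]_n).

Lemma derive_near_cst (V W : normedModType R) (f : V -> W) a x v d :
  (\forall y \near x, f y = a) -> is_derive x v f d -> d = 0.
Proof.
move=> fa [_ <-].
have /near_eq_derive -> : \near x, f x = (cst a : V -> W) x by [].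
exact: derive_cst.
Qed.

Lemma smooth_curve_is_derive (V : normedModType R) (S : set V) x (c : R -> V) :
  smooth_curve S x c -> is_derive (0 : R) 1 c (derive1 c 0).
Proof.
move=> [_ /nbhs_singleton[_ /(_ 0%N) dc]].
by rewrite derive1E; exact: derivableP.
Qed.

(** The equations X P = 0, P^T = P and P P = P hold along the curve near 0, so their derivatives
    vanish there. *)
Lemma tangent_space_sub XP V : tangent_space M XP V -> desing_tangent XP V.
Proof.
move=> [c cM cV]; have dc := smooth_curve_is_derive cM; rewrite cV in dc.
have [c0 cMt] := cM; rewrite -c0.
have dc1 := is_derive_fst dc; have dc2 := is_derive_snd dc.
have nearM : \forall t \near (0 : R), M (c t).
  by apply: filterS cMt => t [].
split.
- apply: (derive_near_cst (a := 0)) (is_derive_mulmx dc1 dc2).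
  by apply: filterS nearM => t [_]; exact.
- apply/eqP; rewrite -subr_eq0; apply/eqP.
  apply: (derive_near_cst (a := 0)) (is_deriveB (is_derive_trmx dc2) dc2).
  apply: filterS nearM => t [[/= cT _ _] _].
  by rewrite -[LHS]/((c t).2^T - (c t).2) cT subrr.
- apply/eqP; rewrite -subr_eq0; apply/eqP.
  have d3 := is_deriveB (is_derive_mulmx dc2 dc2) dc2.
  apply: (derive_near_cst (a := 0) _ d3).
  apply: filterS nearM => t [[/= _ cc _] _].
  by rewrite -[LHS]/((c t).2 *m (c t).2 - (c t).2) cc subrr.
Qed.

(** For skew [W] this is a path of orthogonal matrices through the identity, defined for all t and
    rational in t, so that its smoothness reduces to that of matrix inversion. *)
Definition cayley W (t : R) : 'M[R]_n :=
  (1%:M + t *: W) *m invmx (1%:M - t *: W).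

Lemma cayley_unit W t : W^T = - W -> 1%:M - t *: W \in unitmx.
Proof.
by move=> WT; apply: unitmx_1_sub_skew; rewrite linearZ /= WT scalerN.
Qed.

Lemma cayley_orthogonal W t : W^T = - W -> (cayley W t)^T *m cayley W t = 1%:M.
Proof.
move=> WT; have Um := cayley_unit t WT; have := cayley_unit (- t) WT.
rewrite scaleNr opprK => Up.
have -> : (cayley W t)^T = invmx (1%:M + t *: W) *m (1%:M - t *: W).
  rewrite /cayley trmx_mul trmx_inv linearB linearD /= linearZ /= trmx1.
  by rewrite WT scalerN opprK.
have UC : (1%:M - t *: W) *m (1%:M + t *: W) =
          (1%:M + t *: W) *m (1%:M - t *: W).
  rewrite mulmxBl mulmxDl !mul1mx mulmxDr mulmxBr !mulmx1 opprD !addrA.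
  by congr (_ - _); rewrite addrK subrK.
by rewrite /cayley mulmxA -(mulmxA (invmx _)) UC mulmxA mulVmx // mul1mx mulmxV.
Qed.

Lemma cayley0 W : cayley W 0 = 1%:M.
Proof. by rewrite /cayley !scale0r addr0 subr0 mul1mx invmx1. Qed.

Lemma is_derive_scale_mx p q (A : 'M[R]_(p, q)) (t : R) :
  is_derive t 1 (fun s => s *: A) A.
Proof.
apply/is_derive_mxP => i j.
have -> : (fun s => (s *: A) i j) = (fun s => s) * (fun=> A i j).
  by apply/funext => s; rewrite mxE.
have := is_deriveM (is_derive_id t (1 : R)) (is_derive_cst (A i j) t (1 : R)).
by move=> dM; apply: (is_derive_eq dM); rewrite scaler0 add0r /GRing.scale /= mulr1.
Qed.

Lemma is_derive_cayley W : W^T = - W ->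
  is_derive (0 : R) 1 (cayley W) (W + W).
Proof.
move=> WT; have dW := is_derive_scale_mx W 0.
have d1 := is_derive_cst (1%:M : 'M[R]_n) (0 : R) (1 : R).
have dp := is_deriveD d1 dW; have dm := is_deriveB d1 dW.
have dN := is_derive_invmx (fun t => cayley_unit t WT) dm.
apply: (is_derive_eq (is_derive_mulmx dp dN)).
rewrite -[(cst _ + _) 0]/(1%:M + 0 *: W) scale0r subr0 addr0 invmx1.
by rewrite !mul1mx !mulmx1 add0r sub0r opprK.
Qed.

Lemma smooth_cayley W : W^T = - W -> smooth_mx (cayley W).
Proof.
move=> WT; apply: (smooth_mxM (A := fun t => 1%:M + t *: W)).
  by apply: smooth_mxD; [exact: smooth_mx_cst|exact: smooth_mx_scale].
apply: (smooth_mx_inv (fun t => cayley_unit t WT)).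
by apply: smooth_mxB; [exact: smooth_mx_cst|exact: smooth_mx_scale].
Qed.

Lemma grassmannian_conj k P (U : 'M[R]_n) : U^T *m U = 1%:M ->
  grassmannian k P -> grassmannian k (U *m P *m U^T).
Proof.
move=> UU [PT PP Pk]; split.
- by rewrite !trmx_mul trmxK PT mulmxA.
- transitivity (U *m (P *m (U^T *m U) *m P) *m U^T); first by rewrite !mulmxA.
  by rewrite UU mulmx1 PP.
- have [UT_unit U_unit] := mulmx1_unit UU.
  rewrite mxrankMfree ?row_free_unit // -mxrank_tr trmx_mul.
  by rewrite mxrankMfree ?row_free_unit // mxrank_tr.
Qed.

(* The projectors follow a Cayley-transform rotation with the prescribed initial
   velocity, and [X + t V] is cut down to the rotating kernel complement. *)
Lemma desing_tangent_sub XP V : M XP -> desing_tangent XP V ->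
  tangent_space M XP V.
Proof.
case: XP => X P [GP /= XP]; case: V => Y Z [/= YZ ZT PZ].
have [PT PP _] := GP.
have PZP := idempotent_sandwich_tangent PP PZ.
(* The Cayley path has velocity 2 W = [Z, P] at 0, so the rotated projector has velocity [[Z, P], P]
   = Z P + P Z - 2 P Z P = Z. The half compensates the factor 2. *)
pose W := 2^-1 *: (Z *m P - P *m Z).
have WT : W^T = - W.
  by rewrite /W linearZ linearB /= !trmx_mul PT ZT -scalerN opprB.
have WW : W + W = Z *m P - P *m Z.
  by rewrite /W -scalerDl -{1 2}[2^-1]mul1r -splitr scale1r.
pose Pt t := cayley W t *m P *m (cayley W t)^T.
pose Xt t := (X + t *: Y) *m (1%:M - Pt t).
have sU := smooth_cayley WT.
have sP : smooth_mx Pt.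
  apply: smooth_mxM (smooth_mx_tr sU); apply: smooth_mxM sU _.
  exact: smooth_mx_cst.
have sX : smooth_mx Xt.
  apply: smooth_mxM.
    by apply: smooth_mxD; [exact: smooth_mx_cst|exact: smooth_mx_scale].
  by apply: smooth_mxB sP; exact: smooth_mx_cst.
have P0 : Pt 0 = P by rewrite /Pt cayley0 trmx1 mul1mx mulmx1.
have GPt t : grassmannian (n - r) (Pt t).
  by apply: grassmannian_conj GP; exact: cayley_orthogonal.
have dU := is_derive_cayley WT.
have dP : is_derive (0 : R) 1 Pt Z.
  have dcP := is_derive_cst P (0 : R) (1 : R).
  have dPt := is_derive_mulmx (is_derive_mulmx dU dcP) (is_derive_trmx dU).
  apply: (is_derive_eq dPt); rewrite mulmx0 addr0 cayley0 trmx1 mulmx1 mul1mx.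
  rewrite linearD /= WT -opprD mulmxN WW -/(_ - _).
  rewrite mulmxBl mulmxBr -!mulmxA PP !mulmxA PP PZP subr0 sub0r opprK.
  exact: PZ.
have dX : is_derive (0 : R) 1 Xt Y.
  have dcX := is_derive_cst X (0 : R) (1 : R).
  have dc1 := is_derive_cst (1%:M : 'M[R]_n) (0 : R) (1 : R).
  have dXt := is_derive_mulmx (is_deriveD dcX (is_derive_scale_mx Y 0))
    (is_deriveB dc1 dP).
  apply: (is_derive_eq dXt).
  rewrite -[(cst _ - _) 0]/(1%:M - Pt 0) -[(cst _ + _) 0]/(X + 0 *: Y) P0.
  rewrite scale0r addr0 add0r sub0r mulmxBr mulmx1 mulmxN.
  by rewrite -addrA -opprD YZ subr0.
exists (fun t => (Xt t, Pt t)); last first.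
  by rewrite derive1E; have [_ ->] := is_derive_pair dX dP.
split; first by rewrite /Xt P0 scale0r addr0 mulmxBr mulmx1 XP subr0.
apply: filterE => t; split; last by move=> k; exact: smooth_pair_derivable.
split; first exact: GPt.
have [_ /= PtPt _] := GPt t.
by rewrite /Xt -mulmxA mulmxBl mul1mx PtPt subrr mulmx0.
Qed.

Lemma tangent_space_desing XP : M XP -> tangent_space M XP = desing_tangent XP.
Proof.
move=> MXP; apply/seteqP; split=> V; first exact: tangent_space_sub.
exact: desing_tangent_sub.
Qed.

End TangentSpace.

(** * Riemannian gradient and Hessian *)

Section RiemannianDerivatives.
Variables (R : realType) (m n r : nat) (alpha : R).
Hypothesis alpha_gt0 : 0 < alpha.
Implicit Types (f : 'M[R]_(m, n) -> R) (X Y : 'M[R]_(m, n)) (P Z : 'M[R]_n).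
Local Notation M := (desingularization R m n r).
Local Notation ip := (@desing_inner R m n alpha).

Definition grad_mx f X : 'M[R]_(m, n) := \matrix_(i, j) 'd f X (delta_mx i j).

Definition hess_mx f X Y : 'M[R]_(m, n) :=
  \matrix_(i, j) 'd (fun X' => 'd f X' (delta_mx i j)) X Y.

Lemma frobenius_delta X i j : frobenius (delta_mx i j) X = X i j.
Proof.
rewrite frobeniusE (bigD1 j) //= (bigD1 i) //= big1 ?addr0 => [|i' ni].
  rewrite big1 ?addr0 => [|j' nj]; first by rewrite mxE !eqxx mul1r.
  by rewrite big1 // => i' _; rewrite mxE (negPf nj) andbF mul0r.
by rewrite mxE (negPf ni) mul0r.
Qed.

Lemma diff_frobenius f X Y : 'd f X Y = frobenius (grad_mx f X) Y.
Proof.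
rewrite {1}(matrix_sum_delta Y) linear_sum frobeniusE exchange_big /=.
apply: eq_bigr => i _; rewrite linear_sum; apply: eq_bigr => j _.
by rewrite linearZ mxE /= mulrC.
Qed.

Lemma hess_mxZ f X Y a : hess_mx f X (a *: Y) = a *: hess_mx f X Y.
Proof. by apply/matrixP => i j; rewrite mxE linearZ /= [RHS]mxE [in RHS]mxE. Qed.

Lemma is_derive_grad_mx f (c : R -> 'M[R]_(m, n)) (t : R) dc :
  twice_continuously_differentiable f -> is_derive t 1 c dc ->
  is_derive t 1 (fun s => grad_mx f (c s)) (hess_mx f (c t) dc).
Proof.
move=> [_ f2] dct; apply/is_derive_mxP => i j; rewrite mxE.
under eq_fun do rewrite mxE.
apply: (is_derive_comp_diff (f := fun X => 'd f X (delta_mx i j))) => //.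
by have [] := f2 (delta_mx i j).
Qed.

Lemma desing_innerC U V : ip U V = ip V U.
Proof.
by rewrite /desing_inner frobeniusC (frobeniusC U.2).
Qed.

Lemma desing_innerBl U V W : ip (U - V) W = ip U W - ip V W.
Proof. by rewrite /desing_inner /= !frobeniusBl; lra. Qed.

Lemma desing_inner_eq0 V : ip V V = 0 -> V = 0.
Proof.
case: V => Y Z; rewrite /desing_inner /= => YZ0.
have Y0 := frobenius_ge0 Y; have Z0 := frobenius_ge0 Z.
have aZ0 : 0 <= alpha * frobenius Z Z by rewrite mulr_ge0 // ltW.
congr pair; apply: frobenius_eq0; first lra.
have /eqP : alpha * frobenius Z Z = 0 by lra.
by rewrite mulf_eq0 gt_eqF //= => /eqP.
Qed.

(** This uniqueness is what makes [xget] in [rgrad] and [rhess] return the explicit formulas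
    below. *)
Lemma tangent_inner_inj XP V W : desing_tangent XP V -> desing_tangent XP W ->
  (forall U, desing_tangent XP U -> ip V U = ip W U) -> V = W.
Proof.
move=> TV TW VW; apply/eqP; rewrite -subr_eq0; apply/eqP/desing_inner_eq0.
by rewrite desing_innerBl VW ?subrr //; exact: desing_tangentB.
Qed.

Lemma desing_proj_inner XP V W : M XP -> desing_tangent XP W ->
  ip (desing_proj alpha XP V) W = ip V W.
Proof.
move=> MXP TW; apply/eqP; rewrite eq_sym -subr_eq0 -desing_innerBl; apply/eqP.
exact: (desing_proj_ortho alpha_gt0 V MXP TW).
Qed.

Definition grad_field f XP := desing_proj alpha XP (grad_mx f XP.1, 0).

(** Along a curve the chain rule gives the pairing of its velocity with the ambient gradient (grad
    f, 0); projecting that gradient does not change pairings with tangent vectors. *)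
Lemma rgrad_desing f XP : continuously_differentiable f -> M XP ->
  rgrad ip M (f \o @phi R m n) XP = grad_field f XP.
Proof.
move=> [df _] MXP; have TW := desing_proj_tangent alpha_gt0 (grad_mx f XP.1, 0) MXP.
have dfc c : smooth_curve M XP c ->
    is_derive (0 : R) 1 ((f \o @phi R m n) \o c)
      (ip (grad_field f XP) (derive1 c 0)).
  move=> cM; have dc := smooth_curve_is_derive cM.
  have Tc : desing_tangent XP (derive1 c 0).
    by apply: (@tangent_space_sub _ _ _ r); exists c.
  apply: (is_derive_eq (is_derive_comp_diff (df _) (is_derive_fst dc))).
  rewrite diff_frobenius /grad_field desing_proj_inner // /desing_inner /=.
  by have [-> _] := cM; rewrite frobenius0l mulr0 addr0.
apply: xget_unique; first by split => //; exact: desing_tangent_sub.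
move=> w [Tw dw]; apply: tangent_inner_inj TW _.
  exact: tangent_space_sub Tw.
move=> U /(desing_tangent_sub MXP)[c cM <-].
by have [_ <-] := dw c cM; have [_ <-] := dfc c cM.
Qed.

(** The value of [proj_coef] at (grad f, 0), written out as a formula on the whole ambient space so
    that the product rule applies to it. *)
Definition grad_coef f XP : 'M[R]_n :=
  - (invmx ((2 * alpha)%:M + XP.1^T *m XP.1) *m (XP.1^T *m grad_mx f XP.1 *m XP.2)).

Lemma grad_fieldE f XP : grad_field f XP =
  (grad_mx f XP.1 *m (1%:M - XP.2) - XP.1 *m grad_coef f XP,
   grad_coef f XP + (grad_coef f XP)^T).
Proof.
rewrite /grad_field /desing_proj /=.
suff -> : proj_coef alpha XP.1 XP.2 (grad_mx f XP.1) 0 = grad_coef f XP by [].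
by rewrite /proj_coef linear0 addr0 mulmx0 mul0mx scaler0 sub0r mulmxN.
Qed.

Definition dgrad_coef f XP (U : 'M[R]_(m, n) * 'M[R]_n) : 'M[R]_n :=
  let: (X, P) := XP in let: (Y, Z) := U in
  let S := invmx ((2 * alpha)%:M + X^T *m X) in
  let G := grad_mx f X in
  - (- (S *m (Y^T *m X + X^T *m Y) *m S) *m (X^T *m G *m P) +
     S *m ((Y^T *m G + X^T *m hess_mx f X Y) *m P + X^T *m G *m Z)).

Definition dgrad_field f XP (U : 'M[R]_(m, n) * 'M[R]_n) :
    'M[R]_(m, n) * 'M[R]_n :=
  (hess_mx f XP.1 U.1 *m (1%:M - XP.2) + grad_mx f XP.1 *m (0 - U.2) -
     (U.1 *m grad_coef f XP + XP.1 *m dgrad_coef f XP U),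
   dgrad_coef f XP U + (dgrad_coef f XP U)^T).

Lemma is_derive_grad_coef f (c : R -> 'M[R]_(m, n) * 'M[R]_n) (t : R) dc :
  twice_continuously_differentiable f -> is_derive t 1 c dc ->
  is_derive t 1 (fun s => grad_coef f (c s)) (dgrad_coef f (c t) dc).
Proof.
move=> f2 dct; have dX := is_derive_fst dct; have dP := is_derive_snd dct.
have dG := is_derive_grad_mx f2 dX.
have dXT := is_derive_trmx dX.
have S_unit s : (2 * alpha)%:M + (c s).1^T *m (c s).1 \in unitmx.
  by rewrite unitmx_scalar_add_gram // mulr_gt0.
have dcst := is_derive_cst ((2 * alpha)%:M : 'M[R]_n) t (1 : R).
have dS := is_derive_invmx S_unit (is_deriveD dcst (is_derive_mulmx dXT dX)).
have dK := is_deriveN (is_derive_mulmx dS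
  (is_derive_mulmx (is_derive_mulmx dXT dG) dP)).
apply: (is_derive_eq dK); rewrite /dgrad_coef.
by case: (c t) => X P; case: (dc) => Y Z /=; rewrite add0r.
Qed.

Lemma is_derive_grad_field f (c : R -> 'M[R]_(m, n) * 'M[R]_n) (t : R) dc :
  twice_continuously_differentiable f -> is_derive t 1 c dc ->
  is_derive t 1 (fun s => grad_field f (c s)) (dgrad_field f (c t) dc).
Proof.
move=> f2 dct; have dX := is_derive_fst dct; have dP := is_derive_snd dct.
have dK := is_derive_grad_coef f2 dct; have dG := is_derive_grad_mx f2 dX.
under eq_fun do rewrite grad_fieldE.
have dcst := is_derive_cst (1%:M : 'M[R]_n) t (1 : R).
apply: is_derive_pair (is_deriveD dK (is_derive_trmx dK)).
exact: is_deriveB (is_derive_mulmx dG (is_deriveB dcst dP))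
  (is_derive_mulmx dX dK).
Qed.

(** The explicit field agrees with [rgrad] on the manifold, and a smooth curve stays there near 0,
    so both have the same derivative along it; the Hessian is the tangential part. *)
Lemma rhess_desing f XP U : twice_continuously_differentiable f -> M XP ->
  desing_tangent XP U ->
  rhess ip M (f \o @phi R m n) XP U = desing_proj alpha XP (dgrad_field f XP U).
Proof.
move=> f2 MXP TU; have [f1 _] := f2.
have drgrad c : smooth_curve M XP c -> derive1 c 0 = U ->
    is_derive (0 : R) 1 (rgrad ip M (f \o @phi R m n) \o c) (dgrad_field f XP U).
  move=> cM cU; have dc := smooth_curve_is_derive cM; rewrite cU in dc.
  have := is_derive_grad_field f2 dc; have [-> cMt] := cM.
  apply: near_eq_is_derive; apply: filterS cMt => t [Mct _].
  by rewrite /= rgrad_desing.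
have Tproj := desing_proj_tangent alpha_gt0 (dgrad_field f XP U) MXP.
apply: xget_unique.
  move=> c cM cU; have [dc dcE] := drgrad c cM cU; split => //.
  rewrite derive1E dcE (tangent_space_desing MXP).
  exact: (is_ortho_proj_desing alpha_gt0 _ MXP).
move=> h hP; have [c cM cU] := desing_tangent_sub MXP TU.
have [_ [Th horth]] := hP c cM cU; have [_ dcE] := drgrad c cM cU.
rewrite derive1E dcE (tangent_space_desing MXP) in Th horth.
apply: tangent_inner_inj Th Tproj _ => V TV; rewrite desing_proj_inner //.
by apply/eqP; rewrite eq_sym -subr_eq0 -desing_innerBl horth.
Qed.

End RiemannianDerivatives.

(** * Critical points *)

Section CriticalPoints.
Variables (R : realType) (m n r : nat) (alpha : R).
Hypothesis alpha_gt0 : 0 < alpha.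
Variables (f : 'M[R]_(m, n) -> R) (X : 'M[R]_(m, n)) (P : 'M[R]_n).
Local Notation M := (desingularization R m n r).
Local Notation ip := (@desing_inner R m n alpha).
Local Notation G := (grad_mx f X).
Hypothesis MXP : M (X, P).

(** Write K for [grad_coef]. Since K P = K and K^T P = 0, the component K + K^T = 0 yields K = 0.
    The other component then gives G (1 - P) = 0, and undoing the invertible factor in K gives X^T G
    P = 0. *)
Lemma grad_field_eq0 : grad_field alpha f (X, P) = 0 ->
  [/\ grad_coef alpha f (X, P) = 0, G *m P = G & X^T *m G = 0].
Proof.
have [[/= PT PP _] XP] := MXP.
rewrite grad_fieldE /= => -[].
have PK : P *m grad_coef alpha f (X, P) = 0.
  have := mul_proj_coef alpha_gt0 G 0 PT PP XP.
  by rewrite /proj_coef linear0 addr0 mulmx0 mul0mx scaler0 sub0r mulmxN.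
have KP : grad_coef alpha f (X, P) *m P = grad_coef alpha f (X, P).
  by rewrite /grad_coef /= mulNmx -!mulmxA PP.
move=> GQ KK.
have K0 : grad_coef alpha f (X, P) = 0.
  have KTP : (grad_coef alpha f (X, P))^T *m P = 0.
    by rewrite -{2}PT -trmx_mul PK linear0.
  by rewrite -(mul0mx _ P) -KK mulmxDl KP KTP addr0.
have GP : G *m P = G.
  by move: GQ; rewrite K0 mulmx0 subr0 mulmxBr mulmx1 => /eqP;
    rewrite subr_eq0 => /eqP.
split => //; rewrite -GP mulmxA.
have Su : (2 * alpha)%:M + X^T *m X \in unitmx.
  by rewrite unitmx_scalar_add_gram // mulr_gt0.
apply/eqP; rewrite -oppr_eq0; apply/eqP.
rewrite -[X^T *m _ *m P](mulKVmx Su) -mulmxN -/(grad_coef alpha f (X, P)).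
by rewrite K0 mulmx0.
Qed.

Lemma low_rank_tangent (a : 'cV[R]_m) (p q : 'rV[R]_n) :
  q *m P = 0 -> p *m P = p -> q *m X^T = 0 ->
  desing_tangent (X, P) (a *m q, q^T *m p + p^T *m q).
Proof.
have [[/= PT PP _] XP] := MXP.
move=> qP pP qX; have Pq : P *m q^T = 0 by rewrite -{1}PT -trmx_mul qP linear0.
have Pp : P *m p^T = p^T by rewrite -{1}PT -trmx_mul pP.
have Xq : X *m q^T = 0 by rewrite -{1}[X]trmxK -trmx_mul qX linear0.
have Xp : X *m p^T = 0 by rewrite -Pp mulmxA XP mul0mx.
split => /=.
- by rewrite -mulmxA qP mulmx0 mulmxDr !mulmxA Xq Xp !mul0mx !addr0.
- by rewrite linearD /= !trmx_mul !trmxK addrC.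
- rewrite mulmxDl mulmxDr -!mulmxA pP qP mulmx0 addr0 !mulmxA Pq Pp mul0mx.
  by rewrite add0r.
Qed.

(* [q^T p + p^T q] rotates [q], a vector of [range (1 - P)] killed by [X],
   towards [p] in [range P]. *)
Lemma second_order_low_rank (a : 'cV[R]_m) (p q : 'rV[R]_n) :
  grad_field alpha f (X, P) = 0 ->
  q *m P = 0 -> p *m P = p -> q *m X^T = 0 ->
  ip (a *m q, q^T *m p + p^T *m q)
     (dgrad_field alpha f (X, P) (a *m q, q^T *m p + p^T *m q)) =
  frobenius (a *m q) (hess_mx f X (a *m q)) -
  2 * (frobenius q q * frobenius (a *m p) G).
Proof.
move=> W0 qP pP qX; have [[/= PT PP _] XP] := MXP.
have [K0 GP XG] := grad_field_eq0 W0.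
have [/= TYZ ZT PZ] := low_rank_tangent a qP pP qX.
have YP : a *m q *m P = 0 by rewrite -mulmxA qP mulmx0.
have XZ : X *m (q^T *m p + p^T *m q) = 0 by move: TYZ; rewrite YP add0r.
have qq : q *m q^T = (frobenius q q)%:M.
  by rewrite [LHS]mx11_scalar /frobenius mxtrace_mulC /mxtrace big_ord1.
have pq : p *m q^T = 0.
  by rewrite -pP -mulmxA -{1}PT -trmx_mul qP linear0 mulmx0.
have YZ : a *m q *m (q^T *m p + p^T *m q) = frobenius q q *: (a *m p).
  rewrite mulmxDr !mulmxA -(mulmxA a q) qq -(mulmxA a q p^T).
  have -> : q *m p^T = 0 by rewrite -[LHS]trmxK trmx_mul trmxK pq linear0.
  by rewrite mulmx0 mul0mx addr0 mul_mx_scalar scalemxAl.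
set Y := a *m q in YP YZ TYZ *; set Z := q^T *m p + p^T *m q in XZ YZ ZT PZ TYZ *.
set D := dgrad_coef alpha f (X, P) (Y, Z).
have Su : (2 * alpha)%:M + X^T *m X \in unitmx.
  by rewrite unitmx_scalar_add_gram // mulr_gt0.
(* First-order criticality, X^T G = 0, removes both the derivative of the inverse and the term in
   [Z]. *)
have DE : D = - (invmx ((2 * alpha)%:M + X^T *m X) *m
    ((Y^T *m G + X^T *m hess_mx f X Y) *m P)).
  by rewrite /D /= XG !mul0mx mulmx0 addr0 add0r.
have SD : (2 * alpha) *: D + X^T *m X *m D =
    - ((Y^T *m G + X^T *m hess_mx f X Y) *m P).
  by rewrite -mul_scalar_mx -mulmxDl DE mulmxN mulKVmx.
have Dq : D *m q^T = 0.
  have Pq : P *m q^T = 0 by rewrite -{1}PT -trmx_mul qP linear0.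
  by rewrite DE mulNmx -!mulmxA Pq !mulmx0 oppr0.
rewrite /desing_inner /dgrad_field -/D; move: D DE SD Dq => D DE SD Dq.
rewrite /= K0 mulmx0 !add0r.
have YXD : frobenius Y (X *m D) = 0.
  rewrite /Y frobenius_mulr -mulmxA Dq mulmx0; exact: frobenius0r.
have YH : frobenius Y (hess_mx f X Y *m (1%:M - P)) = frobenius Y (hess_mx f X Y).
  rewrite frobeniusC frobenius_mulr linearB /= trmx1 PT mulmxBr mulmx1 YP subr0.
  by rewrite frobeniusC.
have YGZ : frobenius Y (G *m Z) = frobenius q q * frobenius (a *m p) G.
  by rewrite frobeniusC frobenius_mulr ZT YZ frobeniusC frobeniusZl.
(* Pairing [SD] with [Z] avoids the inverse: X Z = 0 kills every term beginning with X^T. *)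
have ZD : 2 * alpha * frobenius Z D = - (frobenius q q * frobenius (a *m p) G).
  have := congr1 (fun E => frobenius Z E) SD.
  rewrite /= frobeniusDr frobeniusZr frobeniusNr (mulmxDl (Y^T *m G)) frobeniusDr.
  have -> : frobenius Z (X^T *m X *m D) = 0.
    by rewrite frobeniusC -mulmxA frobenius_mull trmxK XZ frobenius0r.
  have -> : frobenius Z (X^T *m hess_mx f X Y *m P) = 0.
    by rewrite frobeniusC -mulmxA frobenius_mull trmxK XZ frobenius0r.
  have -> : frobenius Z (Y^T *m G *m P) = frobenius q q * frobenius (a *m p) G.
    by rewrite frobeniusC -mulmxA GP frobenius_mull trmxK YZ frobeniusC frobeniusZl.
  lra.
have DDT : frobenius Z (D + D^T) = 2 * frobenius Z D.
  by rewrite frobeniusDr -{2}ZT frobenius_tr mulr2n mulrDl mul1r.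
(* The terms - <Y, G Z> and alpha <Z, D + D^T> each contribute - |q|^2 <a p, G>, whence the factor
   2. *)
rewrite frobeniusBr (frobeniusDr (hess_mx f X Y *m _)) YXD YH mulmxN frobeniusNr.
by rewrite YGZ DDT subr0; lra.
Qed.

Lemma linear_coef_eq0 (u v : R) : (forall l, 0 <= l ^+ 2 * u + l * v) -> v = 0.
Proof.
move=> uv; have u0 : 0 <= u by have := uv 1; have := uv (-1); lra.
have u1 : 0 < u + 1 by lra.
(* At this l the form equals - (v / (u + 1))^2; dividing by u + 1 instead of u covers the case u =
   0. *)
have := uv (- v / (u + 1)).
have -> : (- v / (u + 1)) ^+ 2 * u + - v / (u + 1) * v = - (v / (u + 1)) ^+ 2.
  by field; rewrite gt_eqF.
rewrite oppr_ge0 => v0; have /eqP : (v / (u + 1)) ^+ 2 = 0.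
  by apply/eqP; rewrite eq_le v0 sqr_ge0.
by rewrite sqrf_eq0 mulf_eq0 invr_eq0 (gt_eqF u1) orbF => /eqP.
Qed.

Lemma grad_mx_eq0_low_rank : twice_continuously_differentiable f ->
  (\rank X < r)%N -> (r <= n)%N ->
  second_order_critical ip M (f \o @phi R m n) (X, P) -> G = 0.
Proof.
move=> f2 Xr rn [_ grad0 hess_ge0]; have [f1 _] := f2.
have [[/= PT PP Pr] XP] := MXP.
rewrite (rgrad_desing alpha_gt0 f1 MXP) in grad0.
have [_ GP _] := grad_field_eq0 grad0; rewrite -GP.
(* The kernel of [X] has dimension n - rank X > n - r = rank P, so some kernel vector has a nonzero
   component [q] orthogonal to range P. As X P = 0, that component is still killed by [X]. *)
have /rowV0Pn[q] : kermx X^T *m (1%:M - P) != 0.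
  by apply: rank_gt_complement; rewrite mxrank_ker mxrank_tr Pr; lia.
move=> /submxP[D qD] q0.
have PX : P *m X^T = 0 by rewrite -{1}PT -trmx_mul XP linear0.
have qP : q *m P = 0.
  have QP : (1%:M - P) *m P = 0 by rewrite mulmxBl mul1mx PP subrr.
  by rewrite qD -(mulmxA D) -(mulmxA (kermx _)) QP !mulmx0.
have qX : q *m X^T = 0.
  have QX : (1%:M - P) *m X^T = X^T by rewrite mulmxBl mul1mx PX subr0.
  by rewrite qD -(mulmxA D) -(mulmxA (kermx _)) QX mulmx_ker mulmx0.
have qq : frobenius q q != 0 by apply: contraNneq q0 => /frobenius_eq0 ->.
apply/matrixP => i j; rewrite [RHS]mxE.
(* With [p] the j-th row of [P] and [a] the i-th basis vector, <a p, G> is the (i, j) entry of G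
   P. *)
pose p : 'rV[R]_n := delta_mx 0 j *m P.
have pP : p *m P = p by rewrite /p -mulmxA PP.
pose a : 'cV[R]_m := delta_mx i 0.
have apG : frobenius (a *m p) G = (G *m P) i j.
  rewrite /p mulmxA mul_delta_mx frobenius_mulr PT.
  exact: frobenius_delta.
(* Scaling [a] by l scales the first tangent component and leaves the second unchanged, so the
   Hessian of [f] enters quadratically and the gradient linearly. *)
have quad l : 0 <= l ^+ 2 * frobenius (a *m q) (hess_mx f X (a *m q)) +
    l * (- 2 * (frobenius q q * (G *m P) i j)).
  have TU := low_rank_tangent (l *: a) qP pP qX.
  have := hess_ge0 _ (desing_tangent_sub MXP TU).
  rewrite (rhess_desing alpha_gt0 f2 MXP TU) desing_innerC.
  rewrite (desing_proj_inner alpha_gt0 _ MXP TU) desing_innerC.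
  rewrite second_order_low_rank // -!scalemxAl hess_mxZ !frobeniusZl frobeniusZr apG.
  by congr (0 <= _); ring.
have /eqP := linear_coef_eq0 quad.
by rewrite !mulf_eq0 oppr_eq0 pnatr_eq0 (negPf qq) /= => /eqP.
Qed.

End CriticalPoints.

(** * Compactness and accumulation points *)

Section Compactness.
Variable (R : realType).

Lemma cvg_mx (T : Type) (F : set_system T) {FF : Filter F} m n
    (A : T -> 'M[R]_(m, n)) (L : 'M[R]_(m, n)) :
  (forall i j, (fun t => A t i j) @ F --> L i j) -> A @ F --> L.
Proof.
move=> AL; apply/cvgrPdist_le => /= e e0; near=> t.
rewrite /Num.Def.normr /= mx_normrE (bigmax_le _ (ltW e0)) //= => i _.
rewrite !mxE; move: i; near: t; apply: filter_forall => /= i.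
exact: ((cvgrPdist_le _ _).1 (AL i.1 i.2)).
Unshelve. all: by end_near. Qed.

Lemma cvg_coord (T : Type) (F : set_system T) {FF : Filter F} m n
    (A : T -> 'M[R]_(m, n)) (L : 'M[R]_(m, n)) i j :
  A @ F --> L -> (fun t => A t i j) @ F --> L i j.
Proof.
exact: (@continuous_cvg _ _ _ F FF A (fun M : 'M[R]_(m, n) => M i j : R) L
  (@coord_continuous _ _ _ i j L)).
Qed.

Lemma cvg_mulmx (T : Type) (F : set_system T) {FF : Filter F} m n p
    (A : T -> 'M[R]_(m, n)) (B : T -> 'M[R]_(n, p)) (LA : 'M[R]_(m, n))
    (LB : 'M[R]_(n, p)) :
  A @ F --> LA -> B @ F --> LB -> (fun t => A t *m B t) @ F --> LA *m LB.
Proof.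
move=> AL BL; apply: cvg_mx => i j; rewrite mxE; under eq_fun do rewrite mxE.
apply: cvg_big => [|k _]; first exact: add_continuous.
by apply: cvgM; exact: cvg_coord.
Qed.

Lemma cvg_cst_eq (T : Type) (F : set_system T) {FF : ProperFilter F}
    (V : normedModType R) (h : T -> V) (a L : V) :
  (forall t, h t = a) -> h @ F --> L -> L = a.
Proof.
move=> ha hL; have hE : h = cst a by apply/funext.
apply: (@cvg_unique V (@norm_hausdorff _ V) (h @ F) _ _ _ hL).
by rewrite hE; exact: cvg_cst.
Qed.

Lemma closed_fiber (T : topologicalType) m n (h : T -> 'M[R]_(m, n)) a :
  continuous h -> closed [set x | h x = a].
Proof.
move=> hc; apply: (@preimage_closed _ _ h [set a]) => [x _|]; first exact: hc.
exact/accessible_closed_set1/hausdorff_accessible/norm_hausdorff.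
Qed.

(** The trace replaces the rank because it is continuous, which makes the set visibly closed. *)
Lemma grassmannianE n k : grassmannian k =
  [set P : 'M[R]_n | [/\ P^T = P, P *m P = P & \tr P = k%:R]].
Proof.
apply/seteqP; split=> P [PT PP Pk]; split => //.
  by rewrite mxtrace_idempotent // Pk.
by apply/eqP; rewrite -(eqr_nat R) -mxtrace_idempotent // Pk.
Qed.

(** From P = P P^T, the diagonal entry P_ii is the sum of the squares of row i. It dominates each
    P_il^2, in particular its own square. *)
Lemma grassmannian_entry_le1 n k (P : 'M[R]_n) i j :
  grassmannian k P -> -1 <= P i j <= 1.
Proof.
move=> [PT PP _].
have Psqr l : P i l ^+ 2 <= P i i.
  rewrite -{2}PP mxE (bigD1 l) //= -{3}PT mxE -expr2 lerDl.
  by rewrite sumr_ge0 // => l' _; rewrite -{2}PT mxE -expr2 sqr_ge0.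
have Pii : P i i <= 1 by have := Psqr i; nra.
by have := Psqr j => Pij; apply/andP; split; nra.
Qed.

Lemma compact_grassmannian n k : compact (grassmannian k : set 'M[R]_n).
Proof.
(* The Grassmannian is a closed subset of the image of this compact box under the continuous
   reshaping [vec_mx]. *)
pose box := [set v : 'rV[R]_(n * n) | forall i, `[-1, 1]%classic (v 0 i)].
have box_compact : compact box.
  by apply: (@rV_compact R _ (fun=> `[-1, 1]%classic)) => _; exact: segment_compact.
have vec_cont : continuous (@vec_mx R n n).
  move=> v; apply: (@cvg_mx _ (nbhs v) (nbhs_filter v) n n (@vec_mx R n n)) => i j.
  under eq_fun do rewrite mxE.
  rewrite mxE; exact: coord_continuous.
have vbox_compact : compact (@vec_mx R n n @` box).
  by apply: continuous_compact => //; exact: continuous_subspaceT.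
apply: (subclosed_compact _ vbox_compact); last first.
  move=> P GP; exists (mxvec P); last exact: mxvecK.
  move=> l; case/mxvec_indexP: l => i j; rewrite mxvecE /= in_itv /=.
  exact: grassmannian_entry_le1 GP.
rewrite grassmannianE.
have -> : [set P : 'M[R]_n | [/\ P^T = P, P *m P = P & \tr P = k%:R]] =
    [set P | P^T - P = 0] `&` [set P | P *m P - P = 0] `&`
    [set P | \tr P = k%:R].
  apply/seteqP; split=> [P [PT PP Pk]|P [[/= PT PP] Pk]].
    by split => //; split; rewrite /= ?PT ?PP subrr.
  by split => //; apply/eqP; rewrite -subr_eq0; apply/eqP.
apply: closedI; first apply: closedI.
- apply: closed_fiber => P; apply: (cvgB (F := nbhs P)); last exact: cvg_id.
  apply: (@cvg_mx _ (nbhs P) (nbhs_filter P) n n (@trmx R n n)) => i j.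
  rewrite mxE; under eq_fun do rewrite mxE.
  exact: coord_continuous.
- apply: closed_fiber => P; apply: (cvgB (F := nbhs P)); last exact: cvg_id.
  exact: (@cvg_mulmx _ (nbhs P) (nbhs_filter P)).
- have tr_cont : continuous (fun P : 'M[R]_n => \tr P).
    apply: continuous_big => [|i _]; first exact: add_continuous.
    exact: coord_continuous.
  apply: (@preimage_closed _ _ _ [set k%:R : R]) => [P _|]; last exact: closed_eq.
  exact: tr_cont.
Qed.

End Compactness.

(** * Accumulation points through filters *)

Section AccumulationPoints.

(* The filter [F] stands for a subsequence of [u] converging to [x]. *)
Lemma accumulation_subfilter (T : topologicalType) (u : nat -> T) (x : T) :
  accumulation_point u x ->
  exists2 F : set_system nat, ProperFilter F & u @ F --> x /\ \oo `<=` F.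
Proof.
(* [F] is generated by the tails and the preimages of neighbourhoods of [x]; it is proper because
   [u] cannot eventually avoid a neighbourhood of [x]. *)
move=> ux; pose F := [set A : set nat | exists2 U, nbhs x U &
  \forall k \near \oo, U (u k) -> A k].
have F_filter : Filter F.
  split.
  - by exists setT; [exact: filterT|apply: filterE].
  - move=> A B [U xU UA] [V xV VB]; exists (U `&` V); first exact: filterI.
    by apply: filterS2 UA VB => k UA VB [Uk Vk]; split; [exact: UA|exact: VB].
  - move=> A B AB [U xU UA]; exists U => //.
    by apply: filterS UA => k Uk /Uk /AB.
exists F.
  split => // -[U xU U0].
  have uU : (u @ \oo) (~` U) by [].
  by have [y [nUy Uy]] := ux _ _ uU xU.
split=> [U xU|A oA]; first by exists U => //; apply: filterE.
by exists setT; [exact: filterT|apply: filterS oA].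
Qed.

Lemma subfilter_accumulation (T : topologicalType) (u : nat -> T) (x : T)
    (F : set_system nat) : ProperFilter F -> \oo `<=` F ->
  cluster (u @ F) x -> accumulation_point u x.
Proof. by move=> FF oF uFx A B oA; apply: uFx; exact: oF. Qed.

(** Along a filter on which h o u converges to x, compactness provides a cluster point y of u; by
    continuity h y cannot be separated from x. *)
Lemma accumulation_lift (T U : topologicalType) (h : T -> U) (C : set T)
    (u : nat -> T) (x : U) :
  hausdorff_space U -> continuous h -> compact C -> (forall k, C (u k)) ->
  accumulation_point (h \o u) x ->
  exists y, [/\ C y, h y = x & accumulation_point u y].
Proof.
move=> U_hausdorff hc C_compact Cu /accumulation_subfilter[F FF [huF oF]].
have [y [Cy uy]] : C `&` cluster (u @ F) !=set0.
  apply: C_compact; exact: (@filterE _ F _ (u @^-1` C)).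
exists y; split => //; last exact: subfilter_accumulation uy.
apply: U_hausdorff => A B yA xB.
have [z [Az Bz]] := uy (h @^-1` B) (h @^-1` A) (huF _ xB) (hc y _ yA).
by exists (h z).
Qed.

End AccumulationPoints.

(** * Sublevel sets and tangent cones *)

Section Stationarity.
Variables (R : realType) (m n r : nat).
Local Notation M := (desingularization R m n r).
Implicit Types (f : 'M[R]_(m, n) -> R).

Lemma desingularization_rank X P : (r <= n)%N -> M (X, P) ->
  bounded_rank R m n r X.
Proof.
move=> rn [[/= _ _ Pr] /mulmx0_rank_max XP].
by rewrite /bounded_rank /=; move: XP; rewrite Pr; lia.
Qed.

(** The set is the product of two compact sets, the given sublevel set and the Grassmannian, cut by
    the closed condition X P = 0. *)
Lemma compact_desing_sublevel f X0 : (r <= n)%N ->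
  compact [set X | bounded_rank R m n r X /\ f X <= f X0] ->
  compact [set XP | M XP /\ f XP.1 <= f X0].
Proof.
move=> rn K_compact.
have XP_cont : continuous (fun XP : 'M[R]_(m, n) * 'M[R]_n => XP.1 *m XP.2).
  by move=> XP; apply: (@cvg_mulmx _ _ (nbhs XP) (nbhs_filter XP));
    [exact: cvg_fst|exact: cvg_snd].
have -> : [set XP | M XP /\ f XP.1 <= f X0] =
    ([set X | bounded_rank R m n r X /\ f X <= f X0] `*`
      (grassmannian (n - r) : set 'M[R]_n)) `&` [set XP | XP.1 *m XP.2 = 0].
  apply/seteqP; split=> [[X P] [MXP fX]|[X P] [[[/= _ fX] GP] XP]] //.
  have [GP XP] := MXP; split=> //; split=> //; split=> //.
  exact: desingularization_rank MXP.
apply: compact_closedI; last exact: closed_fiber.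
by apply: compact_setX => //; exact: compact_grassmannian.
Qed.

Lemma tangent_cone_ortho X P (G V : 'M[R]_(m, n)) :
  \rank X = r -> M (X, P) -> G *m P = G -> X^T *m G = 0 ->
  tangent_cone (bounded_rank R m n r) X V -> frobenius G V = 0.
Proof.
move=> Xr [/= GP XP] GPG XG [xs [ts [xs_rank ts_gt0 ts0 xsV]]].
have lift k : {Pk | grassmannian (n - r) Pk & xs k *m Pk = 0}.
  by apply: cid2; exact: bounded_rank_lift.
pose Ps k := s2val (lift k).
have GPs k : grassmannian (n - r) (Ps k) by exact: s2valP (lift k).
have xsPs k : xs k *m Ps k = 0 by exact: s2valP' (lift k).
have [P' [GP' PsP']] : grassmannian (n - r) `&` cluster (Ps @ \oo) !=set0.
  apply: compact_grassmannian; exact: (@filterE _ \oo _ (Ps @^-1` _)).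
have [F FF [PsF oF]] := accumulation_subfilter PsP'.
have vF : (fun k => (ts k)^-1 *: (xs k - X)) @ F --> V.
  by move=> A /xsV /oF.
have xF : xs @ F --> X.
  (* Convergence of the difference quotients and ts --> 0 force xs --> X. *)
  have -> : xs = (fun k => ts k *: ((ts k)^-1 *: (xs k - X)) + X).
    apply/funext => k; rewrite scalerA divff ?scale1r ?subrK //.
    by rewrite gt_eqF.
  rewrite -[X in _ --> X]add0r -[X in _ --> X + _](scale0r V).
  apply: cvgD; last exact: cvg_cst.
  by apply: cvgZ vF => A /ts0 /oF.
have XP' : X *m P' = 0.
  exact: cvg_cst_eq xsPs (cvg_mulmx xF PsF).
have GX : G^T *m X = 0 by rewrite -[LHS]trmxK trmx_mul trmxK XG linear0.
(* The products vanish already before the limit, because G^T X = 0 and each [Ps k] is annihilated by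
   [xs k]. *)
have GVP' : G^T *m V *m P' = 0.
  apply: cvg_cst_eq (cvg_mulmx (cvg_mulmx (cvg_cst G^T) vF) PsF) => k.
  by rewrite -scalemxAr mulmxBr GX subr0 -scalemxAl -mulmxA xsPs mulmx0 scaler0.
have PP' := grassmannian_ker_unique Xr GP GP' XP XP'.
have [PT _ _] := GP.
rewrite -GPG frobenius_mulr PT PP' /frobenius mulmxA GVP'.
exact: linear0.
Qed.

End Stationarity.

Theorem theorem4p1 (R : realType) (m n r : nat) (alpha : R)
    (f : 'M[R]_(m, n) -> R) (X0 : 'M[R]_(m, n)) (P0 : 'M[R]_n)
    (m_gt0 : (0 < m)%N) (n_gt0 : (0 < n)%N) (r_gt0 : (0 < r)%N)
    (r_lt : (r < minn m n)%N) (alpha_gt0 : 0 < alpha)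
    (f_C1 : continuously_differentiable f)
    (XP0_in : desingularization R m n r (X0, P0))
    (sublevel_compact :
       compact [set X | bounded_rank R m n r X /\ f X <= f X0]) :
  let M := desingularization R m n r in
  let g := f \o @phi R m n in
  compact [set XP | M XP /\ g XP <= g (X0, P0)] /\
  forall XPs : nat -> 'M[R]_(m, n) * 'M[R]_n,
    XPs 0%N = (X0, P0) ->
    (forall k, M (XPs k)) ->
    (forall k, g (XPs k.+1) <= g (XPs k)) ->
    (exists2 XP, M XP & accumulation_point XPs XP) /\
    (twice_continuously_differentiable f ->
     (forall XP, M XP -> accumulation_point XPs XP ->
        second_order_critical (desing_inner alpha) M g XP) ->
     forall X, accumulation_point (@phi R m n \o XPs) X ->
       stationary (bounded_rank R m n r) f X).
Proof.
move=> M g; have rn : (r <= n)%N by lia.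
have C_compact : compact [set XP | M XP /\ g XP <= g (X0, P0)].
  exact: compact_desing_sublevel rn sublevel_compact.
split=> // XPs XPs0 MXPs g_nincr.
have CXPs k : [set XP | M XP /\ g XP <= g (X0, P0)] (XPs k).
  split=> //; elim: k => [|k IHk]; first by rewrite XPs0.
  exact: le_trans (g_nincr k) IHk.
split.
  have [XP [[MXP _] acc]] := C_compact (XPs @ \oo) _ (filterE _ CXPs).
  by exists XP.
move=> f2 crit X acc.
have phi_cont : continuous (@phi R m n) by move=> XP; exact: cvg_fst.
(* The criticality hypothesis concerns pairs, so an accumulation point of the first components is
   lifted inside the compact sublevel set. *)
have [[X' P] [[MXP _] /= X'X accXP]] :=
  accumulation_lift (@norm_hausdorff _ _) phi_cont C_compact CXPs acc.
rewrite /phi /= in X'X; rewrite {}X'X in MXP accXP.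
have XP_crit := crit _ MXP accXP.
have Xr := desingularization_rank rn MXP.
split=> // V XV; rewrite diff_frobenius.
(* Below rank r the second-order condition makes the whole gradient vanish; at rank exactly r only
   the first-order condition is used. *)
have [rX|rX] := ltnP (\rank X) r.
  by rewrite (grad_mx_eq0_low_rank alpha_gt0 MXP f2 rX rn XP_crit) frobenius0l.
have [_ grad0 _] := XP_crit.
rewrite (rgrad_desing alpha_gt0 f_C1 MXP) in grad0.
have [_ GP XG] := grad_field_eq0 alpha_gt0 MXP grad0.
rewrite (tangent_cone_ortho _ MXP GP XG XV) //.
by apply/eqP; rewrite eqn_leq rX andbT.
Qed.
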